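(* The natural PDE of a given space-like W-surface $S$ in three-dimensional Minkowski space $\mathbb R^3_1$ is the natural PDE of any parallel space-like surface $\bar S(a)$, $a=\mathrm{const}\neq0$, of $S$.
   Context: $\mathbb R^3_1$ carries the standard flat metric of signature $(2,1)$. A surface $z=z(u,v)$, $(u,v)\in\mathcal D$, is space-like if its induced metric is positive definite; its unit normal $l$ satisfies $l^2=-1$. Put $E=z_u^2$, $F=z_uz_v$, $G=z_v^2$, $L=lz_{uu}$, $M=lz_{uv}$, $N=lz_{vv}$. Surfaces are free of umbilical points; $(u,v)$ are principal parameters if $F=M=0$, and then $\nu_1=L/E$, $\nu_2=N/G$ are the principal curvatures and $\gamma_1=-\frac{E_v}{2E\sqrt G}$, $\gamma_2=\frac{G_u}{2G\sqrt E}$ are the principal geodesic curvatures. A space-like surface is a W-surface (Weingarten surface) with Weingarten functions $f,g$ if $\nu_1=f(\nu)$, $\nu_2=g(\nu)$ for a differentiable function $\nu(u,v)$ with values in an interval on which $f,g$ are differentiable with $f'g'\neq0$, $f-g\neq0$. Fix $(u_0,v_0)\in\mathcal D$, $\nu_0=\nu(u_0,v_0)$ and put $I=\int_{\nu_0}^{\nu}\frac{f'\,d\nu}{f-g}$, $J=\int_{\nu_0}^{\nu}\frac{g'\,d\nu}{g-f}$. Principal parameters are natural principal if $\sqrt E\,e^I$ and $\sqrt G\,e^J$ are both constant. Two kinds of W-surfaces are considered: strongly regular ones ($(\nu_1-\nu_2)\gamma_1\gamma_2\ne0$) and those with $\gamma_1=0$, $(\nu_1-\nu_2)\gamma_2\neq0$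 (then $\nu=\nu(u)$). Natural PDE: for a W-surface with natural principal parameters $(u,v)$ and positive constants $\mathfrak a,\mathfrak b$ given by $\mathfrak a^{-2}=E(u_0,v_0)$, $\mathfrak b^{-2}=G(u_0,v_0)$ (so that $\mathfrak a\sqrt E=e^{-I}$, $\mathfrak b\sqrt G=e^{-J}$), the natural PDE is the following equation for $\nu$: $$\mathfrak a^2e^{2I}(J_{uu}+I_uJ_u-J_u^2)+\mathfrak b^2e^{2J}(I_{vv}+I_vJ_v-I_v^2)=-f(\nu)g(\nu)$$ if the surface is strongly regular, respectively (an ODE) $$\mathfrak a^2e^{2I}(J_{uu}+I_uJ_u-J_u^2)=-f(\nu)g(\nu)$$ if $\gamma_1=0$. Parallel surface: $\bar S(a):\ \bar z=z+a\,l$, excluding the points with $(1-a\nu_1)(1-a\nu_2)=0$; it is space-like with unit normal $\bar l=\varepsilon l$, $\varepsilon=\mathrm{sign}\,(1-a\nu_1)(1-a\nu_2)$. It is a W-surface with Weingarten functions $\bar f=\frac{\varepsilon f}{1-af}$, $\bar g=\frac{\varepsilon g}{1-ag}$ of the same function $\nu$, and the natural principal parameters $(u,v)$ of $S$ are natural principal parameters for it. Its natural PDE is the equation above formed in the same parameters $(u,v)$ and for the same $\nu$ and $\nu_0$, with $\bar f,\bar g$ in place of $f,g$ and with the positive constants $\bar{\mathfrak a},\bar{\mathfrak b}$ given by $\bar{\mathfrak a}^{-2}=\mathfrak a^{-2}(1-af(\nu_0))^2$, $\bar{\mathfrak b}^{-2}=\mathfrak b^{-2}(1-ag(\nu_0))^2$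 in place of $\mathfrak a,\mathfrak b$. *)

(* Defs.v *)
From Stdlib Require Import Reals.
From Coquelicot Require Import Coquelicot.
Open Scope R_scope.

(** * Calculus in the (u,v)-plane *)

Definition pu (h : R -> R -> R) (u v : R) : R := Derive (fun s => h s v) u.
Definition pv (h : R -> R -> R) (u v : R) : R := Derive (fun t => h u t) v.

Definition open2 (D : R -> R -> Prop) : Prop :=
  forall u v, D u v -> locally_2d D u v.

Definition C1_on (D : R -> R -> Prop) (h : R -> R -> R) : Prop :=
  forall u v, D u v ->
    ex_derive (fun s => h s v) u /\ ex_derive (fun t => h u t) v /\
    continuity_2d_pt (pu h) u v /\ continuity_2d_pt (pv h) u v.

Definition C2_on (D : R -> R -> Prop) (h : R -> R -> R) : Prop :=
  C1_on D h /\ C1_on D (pu h) /\ C1_on D (pv h).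

Definition open_interval (K : R -> Prop) : Prop :=
  open K /\ forall x y s, K x -> K y -> x <= s <= y -> K s.

Definition C2_fun_on (K : R -> Prop) (f : R -> R) : Prop :=
  forall t, K t ->
    ex_derive f t /\ ex_derive (Derive f) t /\ continuous (Derive (Derive f)) t.

(** * Minkowski space of signature (2,1) *)

Definition vec : Type := (R * R * R)%type.
Definition c1 (x : vec) : R := fst (fst x).
Definition c2 (x : vec) : R := snd (fst x).
Definition c3 (x : vec) : R := snd x.

Definition ip (x y : vec) : R := c1 x * c1 y + c2 x * c2 y - c3 x * c3 y.

Definition vadd (x y : vec) : vec := (c1 x + c1 y, c2 x + c2 y, c3 x + c3 y).
Definition vscal (k : R) (x : vec) : vec := (k * c1 x, k * c2 x, k * c3 x).

Definition vpu (z : R -> R -> vec) (u v : R) : vec :=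
  (pu (fun s t => c1 (z s t)) u v,
   pu (fun s t => c2 (z s t)) u v,
   pu (fun s t => c3 (z s t)) u v).
Definition vpv (z : R -> R -> vec) (u v : R) : vec :=
  (pv (fun s t => c1 (z s t)) u v,
   pv (fun s t => c2 (z s t)) u v,
   pv (fun s t => c3 (z s t)) u v).

Definition componentwise (P : (R -> R -> R) -> Prop) (z : R -> R -> vec) : Prop :=
  P (fun u v => c1 (z u v)) /\ P (fun u v => c2 (z u v)) /\ P (fun u v => c3 (z u v)).

(** * Space-like surfaces *)

(** The unit normal is part of the data, since it is determined only up to sign. *)
Record surface : Type := Surface {
  dom : R -> R -> Prop;
  pos : R -> R -> vec;
  nrm : R -> R -> vec
}.

Definition coefE (X : surface) u v := ip (vpu (pos X) u v) (vpu (pos X) u v).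
Definition coefF (X : surface) u v := ip (vpu (pos X) u v) (vpv (pos X) u v).
Definition coefG (X : surface) u v := ip (vpv (pos X) u v) (vpv (pos X) u v).
Definition coefL (X : surface) u v := ip (nrm X u v) (vpu (vpu (pos X)) u v).
Definition coefM (X : surface) u v := ip (nrm X u v) (vpv (vpu (pos X)) u v).
Definition coefN (X : surface) u v := ip (nrm X u v) (vpv (vpv (pos X)) u v).

Record spacelike (X : surface) : Prop := {
  sl_open : open2 (dom X);
  sl_pos : componentwise (C2_on (dom X)) (pos X);
  sl_metric : forall u v, dom X u v ->
    0 < coefE X u v /\ 0 < coefE X u v * coefG X u v - coefF X u v ^ 2;
  sl_nrm : componentwise (C1_on (dom X)) (nrm X);
  sl_orth : forall u v, dom X u v ->
    ip (nrm X u v) (vpu (pos X) u v) = 0 /\ ip (nrm X u v) (vpv (pos X) u v) = 0;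
  sl_unit : forall u v, dom X u v -> ip (nrm X u v) (nrm X u v) = -1
}.

Definition principal_parameters (X : surface) : Prop :=
  forall u v, dom X u v -> coefF X u v = 0 /\ coefM X u v = 0.

(** The next four are meaningful in principal parameters only. *)
Definition nu1 (X : surface) u v : R := coefL X u v / coefE X u v.
Definition nu2 (X : surface) u v : R := coefN X u v / coefG X u v.
Definition gamma1 (X : surface) u v : R :=
  - (pv (coefE X) u v / (2 * coefE X u v * sqrt (coefG X u v))).
Definition gamma2 (X : surface) u v : R :=
  pu (coefG X) u v / (2 * coefG X u v * sqrt (coefE X u v)).

Inductive kind : Type := StronglyRegular | Gamma1Zero.

Definition of_kind (k : kind) (X : surface) : Prop :=
  match k with
  | StronglyRegular => forall u v, dom X u v ->
      (nu1 X u v - nu2 X u v) * gamma1 X u v * gamma2 X u v <> 0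
  | Gamma1Zero => forall u v, dom X u v ->
      gamma1 X u v = 0 /\ (nu1 X u v - nu2 X u v) * gamma2 X u v <> 0
  end.

(** * W-surfaces and natural principal parameters *)

(** Weingarten functions [wf], [wg] on [itv], and the function [wnu] of (u,v). *)
Record weingarten : Type := Weingarten {
  itv : R -> Prop;
  wf : R -> R;
  wg : R -> R;
  wnu : R -> R -> R
}.

(** [C^2] is the regularity needed for the second derivatives of the
    integrals [I], [J] below to exist. Absence of umbilical points is
    [wf t - wg t <> 0]. *)
Record W_surface (X : surface) (W : weingarten) : Prop := {
  ws_spacelike : spacelike X;
  ws_principal : principal_parameters X;
  ws_itv : open_interval (itv W);
  ws_f : C2_fun_on (itv W) (wf W);
  ws_g : C2_fun_on (itv W) (wg W);
  ws_fg' : forall t, itv W t -> Derive (wf W) t * Derive (wg W) t <> 0;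
  ws_fg : forall t, itv W t -> wf W t - wg W t <> 0;
  ws_nu : C2_on (dom X) (wnu W);
  ws_range : forall u v, dom X u v -> itv W (wnu W u v);
  ws_nu1 : forall u v, dom X u v -> nu1 X u v = wf W (wnu W u v);
  ws_nu2 : forall u v, dom X u v -> nu2 X u v = wg W (wnu W u v)
}.

(** [I = wint f g t0] and [J = wint g f t0], as functions of [nu]. *)
Definition wint (f g : R -> R) (t0 t : R) : R :=
  RInt (fun s => Derive f s / (f s - g s)) t0 t.

Definition natural_parameters (X : surface) (W : weingarten) (u0 v0 : R) : Prop :=
  (exists c, forall u v, dom X u v ->
     sqrt (coefE X u v) * exp (wint (wf W) (wg W) (wnu W u0 v0) (wnu W u v)) = c) /\
  (exists c, forall u v, dom X u v ->
     sqrt (coefG X u v) * exp (wint (wg W) (wf W) (wnu W u0 v0) (wnu W u v)) = c).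

(** * The natural PDE *)

(** The equation for the unknown [om], at the point [(u,v)]; [t0] is the common
    lower limit of the integrals. *)
Definition natural_PDE (k : kind) (W : weingarten) (t0 aa bb : R)
    (om : R -> R -> R) (u v : R) : Prop :=
  let I := fun s t => wint (wf W) (wg W) t0 (om s t) in
  let J := fun s t => wint (wg W) (wf W) t0 (om s t) in
  let U := aa ^ 2 * exp (2 * I u v) *
             (pu (pu J) u v + pu I u v * pu J u v - pu J u v ^ 2) in
  let V := bb ^ 2 * exp (2 * J u v) *
             (pv (pv I) u v + pv I u v * pv J u v - pv I u v ^ 2) in
  let rhs := - (wf W (om u v) * wg W (om u v)) in
  match k with
  | StronglyRegular => U + V = rhs
  | Gamma1Zero => U = rhs
  end.

(** [natural_PDE k W (wnu W u0 v0) aa bb] is the natural PDE of [X]. *)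
Record has_natural_PDE (X : surface) (W : weingarten) (u0 v0 : R)
    (k : kind) (aa bb : R) : Prop := {
  np_W : W_surface X W;
  np_base : dom X u0 v0;
  np_natural : natural_parameters X W u0 v0;
  np_kind : of_kind k X;
  np_aa_pos : 0 < aa;
  np_bb_pos : 0 < bb;
  np_aa : / aa ^ 2 = coefE X u0 v0;
  np_bb : / bb ^ 2 = coefG X u0 v0
}.

(** Two equations for functions with values in [K] are the same when every such
    function satisfies both or neither at each point. The unknown of the
    [Gamma1Zero] equation is a function of [u] alone: these are among the
    [om] below. *)
Definition same_equation (K : R -> Prop)
    (eq1 eq2 : (R -> R -> R) -> R -> R -> Prop) : Prop :=
  forall (U : R -> R -> Prop) (om : R -> R -> R),
    open2 U -> C2_on U om -> (forall u v, U u v -> K (om u v)) ->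
    forall u v, U u v -> (eq1 om u v <-> eq2 om u v).

(** * Parallel surfaces *)

Definition parallel (a : R) (X : surface) : surface :=
  let d := fun u v => (1 - a * nu1 X u v) * (1 - a * nu2 X u v) in
  {| dom := fun u v => dom X u v /\ d u v <> 0;
     pos := fun u v => vadd (pos X u v) (vscal a (nrm X u v));
     nrm := fun u v => vscal (sign (d u v)) (nrm X u v) |}.

Definition restrict (X : surface) (P : R -> R -> Prop) : surface :=
  {| dom := fun u v => dom X u v /\ P u v; pos := pos X; nrm := nrm X |}.

(** The barred integrals from [t0] diverge at the zeros of
    [(1 - a f) (1 - a g)], so the barred functions are taken on the largest
    subinterval around [t0] that contains no such zero. *)
Definition parallel_weingarten (a : R) (W : weingarten) (t0 : R) : weingarten :=
  let d := fun t => (1 - a * wf W t) * (1 - a * wg W t) in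
  {| itv := fun t => itv W t /\ forall s, Rmin t0 t <= s <= Rmax t0 t -> d s <> 0;
     wf := fun t => sign (d t) * wf W t / (1 - a * wf W t);
     wg := fun t => sign (d t) * wg W t / (1 - a * wg W t);
     wnu := wnu W |}.

(* Main.v *)
From Stdlib Require Import Reals Lra.
From Coquelicot Require Import Coquelicot.
Require Import Defs.
Open Scope R_scope.

(** The Weingarten equations [l_u = - nu1 z_u], [l_v = - nu2 z_v] show that the
    parallel surface [z + a l] has tangent vectors [(1 - a nu1) z_u] and
    [(1 - a nu2) z_v]. Hence [E] and [G] are multiplied by [(1 - a nu1)^2] and
    [(1 - a nu2)^2], the parameters stay principal, and [nu1], [nu2] become
    [e nu1 / (1 - a nu1)], [e nu2 / (1 - a nu2)], where [e] is the sign carried by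
    the normal. This sign is constant as long as [nu] stays in an interval on
    which [(1 - a f) (1 - a g)] has no zero. Since [l_u = - f(nu) z_u] with [f(nu)]
    and [z_u] of class C^1, the parallel surface is again of class C^2.

    The rest is a calculation with the Weingarten functions. In the barred
    integrands [e] cancels, and with [q = (1 - a f) / (1 - a g)] they are
    [dIbar = dI / q] and [dJbar = q dJ] ([is_derive_wint_parallel]). Therefore
    [exp (2 Ibar) (1 - a f)^2 = exp (2 I) (1 - a f(nu_0))^2]
    ([exp_wint_parallel]), which makes the parameters natural for the parallel
    surface and fixes the new constants. Substituting in one second-order term of
    the equation, and using
    [q_u = - a (f - g) q (I_u / (1 - a f) + J_u / (1 - a g))] and
    [1 - q = a (f - g) / (1 - a g)], gives
    [Jbar_uu + Ibar_u Jbar_u - Jbar_u^2 = q (J_uu + I_u J_u - J_u^2)], so that this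
    term is divided by [(1 - a f) (1 - a g)] ([natural_term_parallel]). The other
    term follows by interchanging [f] and [g], and the right-hand side is divided
    by the same factor: the two equations are equivalent for every unknown.

    That the parallel surface is of the same kind needs no separate calculation:
    in natural parameters [gamma1] and [gamma2] are nowhere vanishing multiples of
    [nu_v] and [nu_u] ([of_kind_iff]), and [nu] is the same function. *)

(** * Weingarten functions of one variable *)

Lemma open_interval_between (K : R -> Prop) (x y s : R) :
  open_interval K -> K x -> K y -> Rmin x y <= s <= Rmax x y -> K s.
Proof.
  intros [_ HK] Hx Hy.
  unfold Rmin, Rmax; destruct (Rle_dec x y); apply HK; auto.
Qed.

Lemma C2_fun_continuous (K : R -> Prop) (f : R -> R) (t : R) :
  C2_fun_on K f -> K t -> continuous f t.
Proof.
  intros Hf Kt; apply (ex_derive_continuous f t); now apply Hf.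
Qed.

Lemma C2_fun_Derive_continuous (K : R -> Prop) (f : R -> R) (t : R) :
  C2_fun_on K f -> K t -> continuous (Derive f) t.
Proof.
  intros Hf Kt; apply (ex_derive_continuous (Derive f) t); now apply Hf.
Qed.

Lemma is_derive_wint (K : R -> Prop) (f g : R -> R) (t0 t : R) :
  open_interval K -> C2_fun_on K f -> C2_fun_on K g ->
  (forall s, K s -> f s - g s <> 0) -> K t0 -> K t ->
  is_derive (wint f g t0) t (Derive f t / (f t - g t)).
Proof.
  intros HK Hf Hg Hfg K0 Kt.
  assert (Hc : forall s, K s -> continuous (fun s => Derive f s / (f s - g s)) s).
  { intros s Ks.
    apply (continuous_mult (Derive f) (fun s => / (f s - g s))).
    - now apply (C2_fun_Derive_continuous K).
    - apply continuous_Rinv_comp; [|now apply Hfg].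
      apply (continuous_minus f g); now apply (C2_fun_continuous K). }
  apply (is_derive_RInt (fun s => Derive f s / (f s - g s)) (wint f g t0) t0 t);
    [|now apply Hc].
  apply (filter_imp K); [|now apply (proj1 HK)].
  intros s Ks; apply (RInt_correct (fun s => Derive f s / (f s - g s))).
  apply (ex_RInt_continuous (fun s => Derive f s / (f s - g s))).
  intros r Hr; apply Hc; now apply (open_interval_between K t0 s).
Qed.

(** The passage to the parallel surface at distance [a], seen on the Weingarten
    functions alone: [fb] and [gb] are the barred functions and [e], a square
    root of 1, is the sign that the unit normal takes. The sign is kept
    constant, and the relation is symmetric in the two principal directions. *)
Record parallel_pair (K : R -> Prop) (a e : R) (f g fb gb : R -> R) : Prop := {
  pp_itv : open_interval K;
  pp_f : C2_fun_on K f;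
  pp_g : C2_fun_on K g;
  pp_sep : forall t, K t -> f t - g t <> 0;
  pp_nzf : forall t, K t -> 1 - a * f t <> 0;
  pp_nzg : forall t, K t -> 1 - a * g t <> 0;
  pp_sign : e * e = 1;
  pp_fb : forall t, K t -> fb t = e * f t / (1 - a * f t);
  pp_gb : forall t, K t -> gb t = e * g t / (1 - a * g t)
}.

Lemma parallel_pair_swap K a e f g fb gb :
  parallel_pair K a e f g fb gb -> parallel_pair K a e g f gb fb.
Proof.
  intros []; split; auto.
  intros t Kt; specialize (pp_sep0 t Kt); lra.
Qed.

Lemma sqr_one_neq_0 (e : R) : e * e = 1 -> e <> 0.
Proof. intros He H0; rewrite H0 in He; lra. Qed.

Lemma is_derive_parallel K a e f g fb gb t :
  parallel_pair K a e f g fb gb -> K t ->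
  is_derive fb t (e * Derive f t / (1 - a * f t) ^ 2).
Proof.
  intros H Kt.
  apply (is_derive_ext_loc (fun s => e * f s / (1 - a * f s))).
  { apply (filter_imp K); [|now apply (proj1 (pp_itv _ _ _ _ _ _ _ H))].
    intros s Ks; symmetry; now apply (pp_fb _ _ _ _ _ _ _ H). }
  pose proof (pp_nzf _ _ _ _ _ _ _ H t Kt).
  destruct (pp_f _ _ _ _ _ _ _ H t Kt) as [Hd _].
  auto_derive; [now repeat split|].
  change (Derive (fun x : R => f x) t) with (Derive f t). field; auto.
Qed.

Lemma Derive_parallel K a e f g fb gb t :
  parallel_pair K a e f g fb gb -> K t ->
  Derive fb t = e * Derive f t / (1 - a * f t) ^ 2.
Proof.
  intros H Kt; apply is_derive_unique; now apply (is_derive_parallel K a e f g fb gb).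
Qed.

Lemma C2_fun_parallel K a e f g fb gb :
  parallel_pair K a e f g fb gb -> C2_fun_on K fb.
Proof.
  intros H t Kt.
  assert (HK : forall s, K s -> locally s K) by apply (pp_itv _ _ _ _ _ _ _ H).
  assert (H2 : forall s, K s -> is_derive (Derive fb) s
     (e * (Derive (Derive f) s / (1 - a * f s) ^ 2
           + 2 * a * Derive f s ^ 2 / (1 - a * f s) ^ 3))).
  { intros s Ks.
    apply (is_derive_ext_loc (fun s => e * Derive f s / (1 - a * f s) ^ 2)).
    { apply (filter_imp K); [|now apply HK].
      intros r Kr; symmetry; now apply (Derive_parallel K a e f g fb gb). }
    pose proof (pp_nzf _ _ _ _ _ _ _ H s Ks).
    destruct (pp_f _ _ _ _ _ _ _ H s Ks) as [Hd [Hd2 _]].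
    auto_derive; [now repeat split; auto; apply pow_nonzero|].
    change (Derive (fun x : R => f x) s) with (Derive f s).
    change (Derive (fun x : R => Derive f x) s) with (Derive (Derive f) s).
    field; auto. }
  split; [eexists; now apply (is_derive_parallel K a e f g fb gb)|].
  split; [eexists; now apply H2|].
  apply (continuous_ext_loc _ (fun s =>
     e * (Derive (Derive f) s * / (1 - a * f s) ^ 2
           + 2 * a * Derive f s ^ 2 * / (1 - a * f s) ^ 3))).
  { apply (filter_imp K); [|now apply HK].
    intros r Kr; symmetry; now apply is_derive_unique, H2. }
  destruct (pp_f _ _ _ _ _ _ _ H t Kt) as [Hd [Hd2 Hc]].
  assert (Hn : forall n, continuous (fun s => / (1 - a * f s) ^ n) t).
  { intros n; apply (ex_derive_continuous (fun s => / (1 - a * f s) ^ n)).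
    auto_derive; repeat split; auto.
    now apply pow_nonzero, (pp_nzf _ _ _ _ _ _ _ H t Kt). }
  apply (continuous_mult (fun _ => e)); [apply continuous_const|].
  apply (continuous_plus (V := R_NormedModule)).
  - apply (continuous_mult (Derive (Derive f)) (fun s => / (1 - a * f s) ^ 2)); auto.
  - apply (continuous_mult (fun s => 2 * a * Derive f s ^ 2)
             (fun s => / (1 - a * f s) ^ 3)); auto.
    apply (ex_derive_continuous (fun s => 2 * a * Derive f s ^ 2)).
    auto_derive; auto.
Qed.

Lemma parallel_diff K a e f g fb gb t :
  parallel_pair K a e f g fb gb -> K t ->
  fb t - gb t = e * (f t - g t) / ((1 - a * f t) * (1 - a * g t)).
Proof.
  intros H Kt.
  rewrite (pp_fb _ _ _ _ _ _ _ H t Kt), (pp_gb _ _ _ _ _ _ _ H t Kt).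
  field; split; [apply (pp_nzg _ _ _ _ _ _ _ H t Kt)|apply (pp_nzf _ _ _ _ _ _ _ H t Kt)].
Qed.

Lemma parallel_diff_neq_0 K a e f g fb gb t :
  parallel_pair K a e f g fb gb -> K t -> fb t - gb t <> 0.
Proof.
  intros H Kt; rewrite (parallel_diff K a e f g fb gb t H Kt).
  pose proof (pp_nzf _ _ _ _ _ _ _ H t Kt); pose proof (pp_nzg _ _ _ _ _ _ _ H t Kt).
  pose proof (pp_sep _ _ _ _ _ _ _ H t Kt).
  pose proof (sqr_one_neq_0 e (pp_sign _ _ _ _ _ _ _ H)).
  apply Rmult_integral_contrapositive; split.
  - now apply Rmult_integral_contrapositive.
  - now apply Rinv_neq_0_compat, Rmult_integral_contrapositive.
Qed.

(** The sign [e] cancels in the barred integrand, and its quotient by the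
    original one is a quotient of principal stretching factors. *)
Lemma is_derive_wint_parallel K a e f g fb gb t0 t :
  parallel_pair K a e f g fb gb -> K t0 -> K t ->
  is_derive (wint fb gb t0) t
    (Derive f t / (f t - g t) * ((1 - a * g t) / (1 - a * f t))).
Proof.
  intros H K0 Kt.
  replace (_ * _) with (Derive fb t / (fb t - gb t)).
  - apply (is_derive_wint K); auto.
    + apply (pp_itv _ _ _ _ _ _ _ H).
    + now apply (C2_fun_parallel K a e f g fb gb).
    + apply (C2_fun_parallel K a e g f gb fb); now apply parallel_pair_swap.
    + intros s Ks; now apply (parallel_diff_neq_0 K a e f g fb gb).
  - rewrite (parallel_diff K a e f g fb gb t H Kt), (Derive_parallel K a e f g fb gb t H Kt).
    pose proof (pp_nzf _ _ _ _ _ _ _ H t Kt); pose proof (pp_nzg _ _ _ _ _ _ _ H t Kt).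
    pose proof (pp_sep _ _ _ _ _ _ _ H t Kt).
    pose proof (sqr_one_neq_0 e (pp_sign _ _ _ _ _ _ _ H)).
    field; auto.
Qed.

Lemma is_derive_wint_pair K a e f g fb gb t0 t :
  parallel_pair K a e f g fb gb -> K t0 -> K t ->
  is_derive (wint f g t0) t (Derive f t / (f t - g t)).
Proof.
  intros [] K0 Kt; now apply (is_derive_wint K).
Qed.

Lemma wint_t0 f g t0 : wint f g t0 t0 = 0.
Proof. apply (RInt_point t0 (fun s => Derive f s / (f s - g s))). Qed.

(** The exponential factors of the two equations differ by the stretching
    factor: [exp (2 (Ibar - I)) (1 - a f)^2] has zero derivative. *)
Lemma exp_wint_parallel K a e f g fb gb t0 t :
  parallel_pair K a e f g fb gb -> K t0 -> K t ->
  exp (2 * wint fb gb t0 t) * (1 - a * f t) ^ 2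
  = exp (2 * wint f g t0 t) * (1 - a * f t0) ^ 2.
Proof.
  intros H K0 Kt.
  set (h := fun s => exp (2 * wint fb gb t0 s - 2 * wint f g t0 s) * (1 - a * f s) ^ 2).
  assert (Hd : forall s, K s -> is_derive h s 0).
  { intros s Ks.
    pose proof (is_derive_wint_parallel K a e f g fb gb t0 s H K0 Ks) as D1.
    pose proof (is_derive_wint_pair K a e f g fb gb t0 s H K0 Ks) as D2.
    pose proof (proj1 (pp_f _ _ _ _ _ _ _ H s Ks)) as D3.
    unfold h; auto_derive; [repeat split; auto; eexists; eauto|].
    change (Derive (fun x : R => f x) s) with (Derive f s).
    change (Derive (fun x : R => wint f g t0 x) s) with (Derive (wint f g t0) s).
    change (Derive (fun x : R => wint fb gb t0 x) s) with (Derive (wint fb gb t0) s).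
    rewrite (is_derive_unique _ _ _ D1), (is_derive_unique _ _ _ D2).
    pose proof (pp_nzf _ _ _ _ _ _ _ H s Ks). pose proof (pp_sep _ _ _ _ _ _ _ H s Ks).
    field; auto. }
  assert (He : h t = h t0).
  { destruct (Rtotal_order t t0) as [Hlt|[->|Hlt]]; [|reflexivity|].
    - apply (eq_is_derive h t t0); auto.
      intros s Hs; apply Hd; now apply (proj2 (pp_itv _ _ _ _ _ _ _ H) t t0).
    - symmetry; apply (eq_is_derive h t0 t); auto.
      intros s Hs; apply Hd; now apply (proj2 (pp_itv _ _ _ _ _ _ _ H) t0 t). }
  unfold h in He; rewrite !wint_t0 in He.
  replace (2 * 0 - 2 * 0) with 0 in He by ring; rewrite exp_0 in He.
  replace (2 * wint fb gb t0 t) with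
    (2 * wint f g t0 t + (2 * wint fb gb t0 t - 2 * wint f g t0 t)) by ring.
  rewrite exp_plus, Rmult_assoc, He; ring.
Qed.

(** One of the two second-order terms of the natural PDE, along the coordinate
    line on which the unknown is [phi]. Interchanging [f] and [g] gives the
    other term. *)
Definition natural_term (c : R) (f g : R -> R) (t0 : R) (phi : R -> R) (s : R) : R :=
  let I := fun r => wint f g t0 (phi r) in
  let J := fun r => wint g f t0 (phi r) in
  c ^ 2 * exp (2 * I s) *
    (Derive (Derive J) s + Derive I s * Derive J s - Derive J s ^ 2).

(** The term of the parallel surface is the original one divided by
    [(1 - a f) (1 - a g)]; [phi] is arbitrary, not assumed to solve the equation. *)
Lemma natural_term_parallel (K : R -> Prop) (a e : R) (f g fb gb : R -> R) (t0 c cb : R)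
    (phi : R -> R) (s : R) :
  parallel_pair K a e f g fb gb -> K t0 ->
  0 < c -> 0 < cb -> / cb ^ 2 = / c ^ 2 * (1 - a * f t0) ^ 2 ->
  locally s (fun r => K (phi r) /\ ex_derive phi r) -> ex_derive (Derive phi) s ->
  natural_term cb fb gb t0 phi s
  = natural_term c f g t0 phi s / ((1 - a * f (phi s)) * (1 - a * g (phi s))).
Proof.
  intros H K0 Hc Hcb Hccb Hloc Hphi2.
  pose proof (parallel_pair_swap _ _ _ _ _ _ _ H) as H'.
  destruct (locally_singleton s _ Hloc) as [Ks Hphi1].
  assert (Hcomp : forall h d r, ex_derive phi r -> is_derive h (phi r) d ->
            Derive (fun r => h (phi r)) r = d * Derive phi r).
  { intros h d r E1 E2. rewrite Derive_comp; [|eexists; eauto|auto].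
    rewrite (is_derive_unique _ _ _ E2); ring. }
  assert (EI : Derive (fun r => wint f g t0 (phi r)) s
               = Derive f (phi s) / (f (phi s) - g (phi s)) * Derive phi s).
  { apply Hcomp; auto; now apply (is_derive_wint_pair K a e f g fb gb). }
  assert (EIb : Derive (fun r => wint fb gb t0 (phi r)) s
               = Derive f (phi s) / (f (phi s) - g (phi s))
                 * ((1 - a * g (phi s)) / (1 - a * f (phi s))) * Derive phi s).
  { apply Hcomp; auto; now apply (is_derive_wint_parallel K a e f g fb gb). }
  set (j := fun r => Derive g (phi r) / (g (phi r) - f (phi r)) * Derive phi r).
  set (q := fun r => (1 - a * f (phi r)) / (1 - a * g (phi r))).
  assert (EJ : forall r, K (phi r) /\ ex_derive phi r ->
            Derive (fun r => wint g f t0 (phi r)) r = j r).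
  { intros r [Kr Er]; apply Hcomp; auto. now apply (is_derive_wint_pair K a e g f gb fb). }
  assert (EJb : forall r, K (phi r) /\ ex_derive phi r ->
            Derive (fun r => wint gb fb t0 (phi r)) r = j r * q r).
  { intros r [Kr Er]; unfold j, q. rewrite Rmult_assoc, (Rmult_comm (Derive phi r)), <- Rmult_assoc.
    apply Hcomp; auto. now apply (is_derive_wint_parallel K a e g f gb fb). }
  assert (EJJ : Derive (Derive (fun r => wint g f t0 (phi r))) s = Derive j s).
  { apply Derive_ext_loc, (filter_imp _ _ EJ Hloc). }
  assert (EJJb : Derive (Derive (fun r => wint gb fb t0 (phi r))) s
            = Derive (fun r => j r * q r) s).
  { apply Derive_ext_loc, (filter_imp _ _ EJb Hloc). }
  destruct (pp_f _ _ _ _ _ _ _ H _ Ks) as [Ef [Eff _]].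
  destruct (pp_g _ _ _ _ _ _ _ H _ Ks) as [Eg [Egg _]].
  pose proof (pp_nzf _ _ _ _ _ _ _ H _ Ks) as Nf.
  pose proof (pp_nzg _ _ _ _ _ _ _ H _ Ks) as Ng.
  pose proof (pp_sep _ _ _ _ _ _ _ H _ Ks) as Nfg.
  pose proof (pp_sep _ _ _ _ _ _ _ H' _ Ks) as Ngf.
  assert (Dj : ex_derive j s).
  { unfold j; auto_derive; repeat split; auto. }
  assert (Dq : is_derive q s
     ((- (a * Derive f (phi s)) * (1 - a * g (phi s))
       + (1 - a * f (phi s)) * (a * Derive g (phi s))) * Derive phi s
      / (1 - a * g (phi s)) ^ 2)).
  { unfold q; auto_derive; [repeat split; auto|].
    change (Derive (fun x : R => f x)) with (Derive f).
    change (Derive (fun x : R => g x)) with (Derive g).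
    change (Derive (fun x : R => phi x)) with (Derive phi).
    field; auto. }
  assert (EM : Derive (fun r => j r * q r) s = Derive j s * q s + j s * Derive q s).
  { apply Derive_mult; auto; eexists; eauto. }
  unfold natural_term; cbv zeta.
  rewrite EJJb, EM, EJJ, EI, EIb, (EJ s), (EJb s), (is_derive_unique _ _ _ Dq) by auto.
  pose proof (exp_wint_parallel K a e f g fb gb t0 (phi s) H K0 Ks) as Hexp.
  pose proof (pp_nzf _ _ _ _ _ _ _ H _ K0) as N0.
  assert (Hc2 : cb ^ 2 * (1 - a * f t0) ^ 2 = c ^ 2).
  { apply Rinv_eq_reg. rewrite Rinv_mult, Hccb. field; split; lra. }
  assert (Hexp' : cb ^ 2 * exp (2 * wint fb gb t0 (phi s))
            = c ^ 2 * exp (2 * wint f g t0 (phi s)) / (1 - a * f (phi s)) ^ 2).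
  { rewrite <- Hc2. apply (Rmult_eq_reg_r ((1 - a * f (phi s)) ^ 2));
      [|now apply pow_nonzero].
    rewrite Rmult_assoc, Hexp. field; auto. }
  rewrite Hexp'. generalize (Derive j s); intros Z.
  generalize (exp (2 * wint f g t0 (phi s))); intros X.
  unfold q, j. field; auto.
Qed.

(** * Calculus on open subsets of the plane *)

Lemma open2_locally_u (D P : R -> R -> Prop) (u v : R) :
  open2 D -> D u v -> (forall s t, D s t -> P s t) -> locally u (fun s => P s v).
Proof.
  intros HD Duv HP; apply (locally_2d_1d_const_y P).
  apply (locally_2d_impl D); [|now apply HD].
  now apply locally_2d_forall; intros s t; apply HP.
Qed.

Lemma open2_locally_v (D P : R -> R -> Prop) (u v : R) :
  open2 D -> D u v -> (forall s t, D s t -> P s t) -> locally v (fun t => P u t).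
Proof.
  intros HD Duv HP; apply (locally_2d_1d_const_x P).
  apply (locally_2d_impl D); [|now apply HD].
  now apply locally_2d_forall; intros s t; apply HP.
Qed.

Lemma pu_ext_on (D : R -> R -> Prop) (h k : R -> R -> R) (u v : R) :
  open2 D -> (forall s t, D s t -> h s t = k s t) -> D u v -> pu h u v = pu k u v.
Proof.
  intros HD E Duv; apply Derive_ext_loc.
  now apply (open2_locally_u D (fun s t => h s t = k s t)).
Qed.

Lemma pv_ext_on (D : R -> R -> Prop) (h k : R -> R -> R) (u v : R) :
  open2 D -> (forall s t, D s t -> h s t = k s t) -> D u v -> pv h u v = pv k u v.
Proof.
  intros HD E Duv; apply Derive_ext_loc.
  now apply (open2_locally_v D (fun s t => h s t = k s t)).
Qed.

Lemma continuity_2d_pt_ext_on (D : R -> R -> Prop) (h k : R -> R -> R) (u v : R) :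
  open2 D -> (forall s t, D s t -> h s t = k s t) -> D u v ->
  continuity_2d_pt h u v -> continuity_2d_pt k u v.
Proof.
  intros HD E Duv; apply continuity_2d_pt_ext_loc.
  apply (locally_2d_impl D); [|now apply HD].
  now apply locally_2d_forall; intros s t; apply E.
Qed.

Lemma C1_on_ext (D : R -> R -> Prop) (h k : R -> R -> R) :
  open2 D -> (forall s t, D s t -> h s t = k s t) -> C1_on D h -> C1_on D k.
Proof.
  intros HD E Hh u v Duv; destruct (Hh u v Duv) as (A & B & C & F).
  repeat split.
  - apply (ex_derive_ext_loc (fun s => h s v)); auto.
    now apply (open2_locally_u D (fun s t => h s t = k s t)).
  - apply (ex_derive_ext_loc (fun t => h u t)); auto.
    now apply (open2_locally_v D (fun s t => h s t = k s t)).
  - apply (continuity_2d_pt_ext_on D (pu h)); auto.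
    intros s t; now apply pu_ext_on.
  - apply (continuity_2d_pt_ext_on D (pv h)); auto.
    intros s t; now apply pv_ext_on.
Qed.

Lemma C1_on_subset (D D' : R -> R -> Prop) (h : R -> R -> R) :
  (forall u v, D' u v -> D u v) -> C1_on D h -> C1_on D' h.
Proof. intros HD Hh u v Duv; now apply Hh, HD. Qed.

Lemma C2_on_subset (D D' : R -> R -> Prop) (h : R -> R -> R) :
  (forall u v, D' u v -> D u v) -> C2_on D h -> C2_on D' h.
Proof.
  intros HD (A & B & C); split; [|split]; now apply (C1_on_subset D).
Qed.

(** Continuous partial derivatives make the function differentiable, hence
    continuous in both variables together. *)
Lemma C1_on_continuity_2d (D : R -> R -> Prop) (h : R -> R -> R) (u v : R) :
  open2 D -> C1_on D h -> D u v -> continuity_2d_pt h u v.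
Proof.
  intros HD Hh Duv; apply differentiable_continuity_pt.
  exists (pu h u v), (pv h u v).
  apply filterdiff_differentiable_pt_lim.
  apply (is_derive_filterdiff h u v (pu h) (pv h u v)).
  - apply (locally_2d_locally
      (fun s t => is_derive (fun z : R_AbsRing => h z t) s (pu h s t)) u v).
    apply (locally_2d_impl D); [|now apply HD].
    apply locally_2d_forall; intros s t Dst.
    exact (Derive_correct _ _ (proj1 (Hh s t Dst))).
  - exact (Derive_correct _ _ (proj1 (proj2 (Hh u v Duv)))).
  - apply (continuity_2d_pt_filterlim (pu h) u v); now apply (Hh u v Duv).
Qed.

Lemma C1_on_const (D : R -> R -> Prop) (c : R) : C1_on D (fun _ _ => c).
Proof.
  intros u v _; repeat split; try apply ex_derive_const.
  - apply (continuity_2d_pt_ext (fun _ _ => 0)); [|apply continuity_2d_pt_const].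
    intros s t; symmetry; exact (Derive_const c _).
  - apply (continuity_2d_pt_ext (fun _ _ => 0)); [|apply continuity_2d_pt_const].
    intros s t; symmetry; exact (Derive_const c _).
Qed.

Lemma C1_on_plus (D : R -> R -> Prop) (h k : R -> R -> R) :
  open2 D -> C1_on D h -> C1_on D k -> C1_on D (fun u v => h u v + k u v).
Proof.
  intros HD Hh Hk u v Duv.
  destruct (Hh u v Duv) as (A1 & B1 & C1 & F1), (Hk u v Duv) as (A2 & B2 & C2 & F2).
  repeat split.
  - now apply (ex_derive_plus (fun s => h s v) (fun s => k s v)).
  - now apply (ex_derive_plus (fun t => h u t) (fun t => k u t)).
  - apply (continuity_2d_pt_ext_on D (fun s t => pu h s t + pu k s t)); auto.
    + intros s t Dst; symmetry.
      apply Derive_plus; [now apply (Hh s t)|now apply (Hk s t)].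
    + now apply continuity_2d_pt_plus.
  - apply (continuity_2d_pt_ext_on D (fun s t => pv h s t + pv k s t)); auto.
    + intros s t Dst; symmetry.
      apply Derive_plus; [now apply (Hh s t)|now apply (Hk s t)].
    + now apply continuity_2d_pt_plus.
Qed.

Lemma pu_mult (h k : R -> R -> R) (u v : R) :
  ex_derive (fun s => h s v) u -> ex_derive (fun s => k s v) u ->
  pu (fun s t => h s t * k s t) u v = pu h u v * k u v + h u v * pu k u v.
Proof. intros; now apply (Derive_mult (fun s => h s v) (fun s => k s v)). Qed.

Lemma pv_mult (h k : R -> R -> R) (u v : R) :
  ex_derive (fun t => h u t) v -> ex_derive (fun t => k u t) v ->
  pv (fun s t => h s t * k s t) u v = pv h u v * k u v + h u v * pv k u v.
Proof. intros; now apply (Derive_mult (fun t => h u t) (fun t => k u t)). Qed.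

Lemma C1_on_mult (D : R -> R -> Prop) (h k : R -> R -> R) :
  open2 D -> C1_on D h -> C1_on D k -> C1_on D (fun u v => h u v * k u v).
Proof.
  intros HD Hh Hk u v Duv.
  pose proof (C1_on_continuity_2d D h u v HD Hh Duv) as Ch.
  pose proof (C1_on_continuity_2d D k u v HD Hk Duv) as Ck.
  destruct (Hh u v Duv) as (A1 & B1 & C1 & F1), (Hk u v Duv) as (A2 & B2 & C2 & F2).
  repeat split.
  - now apply ex_derive_mult.
  - now apply ex_derive_mult.
  - apply (continuity_2d_pt_ext_on D
      (fun s t => pu h s t * k s t + h s t * pu k s t)); auto.
    + intros s t Dst; symmetry.
      apply pu_mult; [now apply (Hh s t)|now apply (Hk s t)].
    + apply continuity_2d_pt_plus; now apply continuity_2d_pt_mult.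
  - apply (continuity_2d_pt_ext_on D
      (fun s t => pv h s t * k s t + h s t * pv k s t)); auto.
    + intros s t Dst; symmetry.
      apply pv_mult; [now apply (Hh s t)|now apply (Hk s t)].
    + apply continuity_2d_pt_plus; now apply continuity_2d_pt_mult.
Qed.

Lemma C1_on_comp (D : R -> R -> Prop) (K : R -> Prop) (f : R -> R) (h : R -> R -> R) :
  open2 D -> C1_on D h -> (forall u v, D u v -> K (h u v)) -> C2_fun_on K f ->
  C1_on D (fun u v => f (h u v)).
Proof.
  intros HD Hh HK Hf u v Duv.
  assert (Cf : continuity_2d_pt (fun s t => Derive f (h s t)) u v).
  { apply continuity_1d_2d_pt_comp; [|now apply (C1_on_continuity_2d D)].
    apply continuity_pt_filterlim, (C2_fun_Derive_continuous K); auto. }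
  destruct (Hh u v Duv) as (A & B & C & F).
  repeat split.
  - apply (ex_derive_comp f (fun s => h s v)); auto; now apply Hf, HK.
  - apply (ex_derive_comp f (fun t => h u t)); auto; now apply Hf, HK.
  - apply (continuity_2d_pt_ext_on D (fun s t => pu h s t * Derive f (h s t))); auto.
    + intros s t Dst; symmetry.
      apply (Derive_comp f (fun s => h s t)); [now apply Hf, HK|now apply (Hh s t)].
    + now apply continuity_2d_pt_mult.
  - apply (continuity_2d_pt_ext_on D (fun s t => pv h s t * Derive f (h s t))); auto.
    + intros s t Dst; symmetry.
      apply (Derive_comp f (fun t => h s t)); [now apply Hf, HK|now apply (Hh s t)].
    + now apply continuity_2d_pt_mult.
Qed.

Lemma pu_pv_comm (D : R -> R -> Prop) (h : R -> R -> R) (u v : R) :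
  open2 D -> C2_on D h -> D u v -> pu (pv h) u v = pv (pu h) u v.
Proof.
  intros HD (H & Hu & Hv) Duv; apply (Schwarz h).
  - apply (locally_2d_impl D); [|now apply HD].
    apply locally_2d_forall; intros s t Dst.
    repeat split; [now apply (H s t)|now apply (H s t)|now apply (Hv s t)|now apply (Hu s t)].
  - apply (Hv u v Duv).
  - apply (Hu u v Duv).
Qed.

(** * Vector fields in Minkowski space *)

Lemma vec_eq (x y : vec) : c1 x = c1 y -> c2 x = c2 y -> c3 x = c3 y -> x = y.
Proof.
  destruct x as [[x1 x2] x3], y as [[y1 y2] y3]; unfold c1, c2, c3; simpl.
  now intros -> -> ->.
Qed.

Lemma ip_comm (x y : vec) : ip x y = ip y x.
Proof. unfold ip; ring. Qed.

Lemma ip_scal_l (k : R) (x y : vec) : ip (vscal k x) y = k * ip x y.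
Proof. unfold ip, vscal, c1, c2, c3; simpl; ring. Qed.

Lemma ip_scal_r (k : R) (x y : vec) : ip x (vscal k y) = k * ip x y.
Proof. unfold ip, vscal, c1, c2, c3; simpl; ring. Qed.

Lemma vpu_ext_on (D : R -> R -> Prop) (x y : R -> R -> vec) (u v : R) :
  open2 D -> (forall s t, D s t -> x s t = y s t) -> D u v -> vpu x u v = vpu y u v.
Proof.
  intros HD E Duv; apply vec_eq; refine (pu_ext_on D _ _ u v HD _ Duv);
    intros s t Dst; now rewrite E.
Qed.

Lemma vpv_ext_on (D : R -> R -> Prop) (x y : R -> R -> vec) (u v : R) :
  open2 D -> (forall s t, D s t -> x s t = y s t) -> D u v -> vpv x u v = vpv y u v.
Proof.
  intros HD E Duv; apply vec_eq; refine (pv_ext_on D _ _ u v HD _ Duv);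
    intros s t Dst; now rewrite E.
Qed.

Lemma componentwise_C2_C1 (D : R -> R -> Prop) (x : R -> R -> vec) :
  componentwise (C2_on D) x ->
  componentwise (C1_on D) x /\ componentwise (C1_on D) (vpu x) /\
  componentwise (C1_on D) (vpv x).
Proof. intros ((A1 & A2 & A3) & (B1 & B2 & B3) & (C1 & C2 & C3)).
  exact (conj (conj A1 (conj B1 C1)) (conj (conj A2 (conj B2 C2)) (conj A3 (conj B3 C3)))).
Qed.

Lemma pu_ip (D : R -> R -> Prop) (x y : R -> R -> vec) (u v : R) :
  componentwise (C1_on D) x -> componentwise (C1_on D) y -> D u v ->
  pu (fun s t => ip (x s t) (y s t)) u v
  = ip (vpu x u v) (y u v) + ip (x u v) (vpu y u v).
Proof.
  intros (X1 & X2 & X3) (Y1 & Y2 & Y3) Duv.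
  destruct (X1 u v Duv) as [x1 _], (X2 u v Duv) as [x2 _], (X3 u v Duv) as [x3 _].
  destruct (Y1 u v Duv) as [y1 _], (Y2 u v Duv) as [y2 _], (Y3 u v Duv) as [y3 _].
  unfold pu at 1, ip at 1.
  rewrite (Derive_minus (fun s => c1 (x s v) * c1 (y s v) + c2 (x s v) * c2 (y s v))
    (fun s => c3 (x s v) * c3 (y s v))).
  2: now apply @ex_derive_plus; apply ex_derive_mult.
  2: now apply ex_derive_mult.
  rewrite (Derive_plus (fun s => c1 (x s v) * c1 (y s v))
    (fun s => c2 (x s v) * c2 (y s v))) by now apply ex_derive_mult.
  rewrite !Derive_mult by auto.
  unfold ip, vpu, pu, c1, c2, c3; simpl; ring.
Qed.

Lemma pv_ip (D : R -> R -> Prop) (x y : R -> R -> vec) (u v : R) :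
  componentwise (C1_on D) x -> componentwise (C1_on D) y -> D u v ->
  pv (fun s t => ip (x s t) (y s t)) u v
  = ip (vpv x u v) (y u v) + ip (x u v) (vpv y u v).
Proof.
  intros (X1 & X2 & X3) (Y1 & Y2 & Y3) Duv.
  destruct (X1 u v Duv) as (_ & x1 & _), (X2 u v Duv) as (_ & x2 & _),
    (X3 u v Duv) as (_ & x3 & _).
  destruct (Y1 u v Duv) as (_ & y1 & _), (Y2 u v Duv) as (_ & y2 & _),
    (Y3 u v Duv) as (_ & y3 & _).
  unfold pv at 1, ip at 1.
  rewrite (Derive_minus (fun t => c1 (x u t) * c1 (y u t) + c2 (x u t) * c2 (y u t))
    (fun t => c3 (x u t) * c3 (y u t))).
  2: now apply @ex_derive_plus; apply ex_derive_mult.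
  2: now apply ex_derive_mult.
  rewrite (Derive_plus (fun t => c1 (x u t) * c1 (y u t))
    (fun t => c2 (x u t) * c2 (y u t))) by now apply ex_derive_mult.
  rewrite !Derive_mult by auto.
  unfold ip, vpv, pv, c1, c2, c3; simpl; ring.
Qed.

Lemma vpu_scal_const (k : R) (x : R -> R -> vec) (u v : R) :
  vpu (fun s t => vscal k (x s t)) u v = vscal k (vpu x u v).
Proof.
  unfold vpu, vscal, pu, c1, c2, c3; simpl; now rewrite !Derive_scal.
Qed.

Lemma vpv_scal_const (k : R) (x : R -> R -> vec) (u v : R) :
  vpv (fun s t => vscal k (x s t)) u v = vscal k (vpv x u v).
Proof.
  unfold vpv, vscal, pv, c1, c2, c3; simpl; now rewrite !Derive_scal.
Qed.

Lemma vpu_add_scal (D : R -> R -> Prop) (k : R) (x y : R -> R -> vec) (u v : R) :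
  componentwise (C1_on D) x -> componentwise (C1_on D) y -> D u v ->
  vpu (fun s t => vadd (x s t) (vscal k (y s t))) u v
  = vadd (vpu x u v) (vscal k (vpu y u v)).
Proof.
  intros (X1 & X2 & X3) (Y1 & Y2 & Y3) Duv.
  destruct (X1 u v Duv) as [x1 _], (X2 u v Duv) as [x2 _], (X3 u v Duv) as [x3 _].
  destruct (Y1 u v Duv) as [y1 _], (Y2 u v Duv) as [y2 _], (Y3 u v Duv) as [y3 _].
  apply vec_eq; unfold vpu, vadd, vscal, pu, c1, c2, c3 in *; simpl in *;
    (rewrite Derive_plus, Derive_scal; [reflexivity|auto|now apply ex_derive_scal]).
Qed.

Lemma vpv_add_scal (D : R -> R -> Prop) (k : R) (x y : R -> R -> vec) (u v : R) :
  componentwise (C1_on D) x -> componentwise (C1_on D) y -> D u v ->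
  vpv (fun s t => vadd (x s t) (vscal k (y s t))) u v
  = vadd (vpv x u v) (vscal k (vpv y u v)).
Proof.
  intros (X1 & X2 & X3) (Y1 & Y2 & Y3) Duv.
  destruct (X1 u v Duv) as (_ & x1 & _), (X2 u v Duv) as (_ & x2 & _),
    (X3 u v Duv) as (_ & x3 & _).
  destruct (Y1 u v Duv) as (_ & y1 & _), (Y2 u v Duv) as (_ & y2 & _),
    (Y3 u v Duv) as (_ & y3 & _).
  apply vec_eq; unfold vpv, vadd, vscal, pv, c1, c2, c3 in *; simpl in *;
    (rewrite Derive_plus, Derive_scal; [reflexivity|auto|now apply ex_derive_scal]).
Qed.

(** Two space-like and one time-like vectors, mutually orthogonal, span the
    whole space: the square of their determinant is minus the Gram determinant. *)
Lemma ip_nondegenerate (p q l w : vec) :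
  0 < ip p p -> 0 < ip q q -> ip p q = 0 -> ip l p = 0 -> ip l q = 0 -> ip l l = -1 ->
  ip w p = 0 -> ip w q = 0 -> ip w l = 0 -> w = (0, 0, 0).
Proof.
  destruct p as [[p1 p2] p3], q as [[q1 q2] q3], l as [[l1 l2] l3], w as [[w1 w2] w3].
  unfold ip, c1, c2, c3; simpl; intros Hp Hq Hpq Hlp Hlq Hll Wp Wq Wl.
  set (d := p1 * (q2 * l3 - q3 * l2) - p2 * (q1 * l3 - q3 * l1)
            + p3 * (q1 * l2 - q2 * l1)).
  assert (Hd : d ^ 2 = (p1 * p1 + p2 * p2 - p3 * p3) * (q1 * q1 + q2 * q2 - q3 * q3)).
  { transitivity (- ((p1 * p1 + p2 * p2 - p3 * p3) *
       ((q1 * q1 + q2 * q2 - q3 * q3) * (l1 * l1 + l2 * l2 - l3 * l3)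
        - (l1 * q1 + l2 * q2 - l3 * q3) ^ 2)
      - (p1 * q1 + p2 * q2 - p3 * q3) *
       ((p1 * q1 + p2 * q2 - p3 * q3) * (l1 * l1 + l2 * l2 - l3 * l3)
        - (l1 * q1 + l2 * q2 - l3 * q3) * (l1 * p1 + l2 * p2 - l3 * p3))
      + (l1 * p1 + l2 * p2 - l3 * p3) *
       ((p1 * q1 + p2 * q2 - p3 * q3) * (l1 * q1 + l2 * q2 - l3 * q3)
        - (q1 * q1 + q2 * q2 - q3 * q3) * (l1 * p1 + l2 * p2 - l3 * p3)))).
    - unfold d; ring.
    - rewrite Hpq, Hlp, Hlq, Hll; ring. }
  assert (Hd0 : d <> 0).
  { intros E; rewrite E in Hd; pose proof (Rmult_lt_0_compat _ _ Hp Hq); nra. }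
  assert (W1 : d * w1 = 0).
  { transitivity ((w1 * p1 + w2 * p2 - w3 * p3) * (q2 * l3 - q3 * l2)
      - (w1 * q1 + w2 * q2 - w3 * q3) * (p2 * l3 - p3 * l2)
      + (w1 * l1 + w2 * l2 - w3 * l3) * (p2 * q3 - p3 * q2)); [unfold d; ring|].
    rewrite Wp, Wq, Wl; ring. }
  assert (W2 : d * w2 = 0).
  { transitivity (- ((w1 * p1 + w2 * p2 - w3 * p3) * (q1 * l3 - q3 * l1)
      - (w1 * q1 + w2 * q2 - w3 * q3) * (p1 * l3 - p3 * l1)
      + (w1 * l1 + w2 * l2 - w3 * l3) * (p1 * q3 - p3 * q1))); [unfold d; ring|].
    rewrite Wp, Wq, Wl; ring. }
  assert (W3 : d * w3 = 0).
  { transitivity (- ((w1 * p1 + w2 * p2 - w3 * p3) * (q1 * l2 - q2 * l1)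
      - (w1 * q1 + w2 * q2 - w3 * q3) * (p1 * l2 - p2 * l1)
      + (w1 * l1 + w2 * l2 - w3 * l3) * (p1 * q2 - p2 * q1))); [unfold d; ring|].
    rewrite Wp, Wq, Wl; ring. }
  destruct (Rmult_integral _ _ W1) as [ | ->]; [easy|].
  destruct (Rmult_integral _ _ W2) as [ | ->]; [easy|].
  now destruct (Rmult_integral _ _ W3) as [ | ->].
Qed.

(** * The Weingarten equations *)

Lemma spacelike_C1 (Y : surface) :
  spacelike Y ->
  componentwise (C1_on (dom Y)) (pos Y) /\ componentwise (C1_on (dom Y)) (vpu (pos Y)) /\
  componentwise (C1_on (dom Y)) (vpv (pos Y)) /\ componentwise (C1_on (dom Y)) (nrm Y).
Proof.
  intros HY; destruct (componentwise_C2_C1 _ _ (sl_pos Y HY)) as (A & B & C).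
  exact (conj A (conj B (conj C (sl_nrm Y HY)))).
Qed.

Lemma pu_const_on (D : R -> R -> Prop) (h : R -> R -> R) (c u v : R) :
  open2 D -> (forall s t, D s t -> h s t = c) -> D u v -> pu h u v = 0.
Proof.
  intros HD E Duv; rewrite (pu_ext_on D h (fun _ _ => c)); auto.
  exact (Derive_const c u).
Qed.

Lemma pv_const_on (D : R -> R -> Prop) (h : R -> R -> R) (c u v : R) :
  open2 D -> (forall s t, D s t -> h s t = c) -> D u v -> pv h u v = 0.
Proof.
  intros HD E Duv; rewrite (pv_ext_on D h (fun _ _ => c)); auto.
  exact (Derive_const c v).
Qed.

Lemma coefL_nrm (Y : surface) (u v : R) :
  spacelike Y -> dom Y u v -> coefL Y u v = - ip (vpu (nrm Y) u v) (vpu (pos Y) u v).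
Proof.
  intros HY Duv; destruct (spacelike_C1 Y HY) as (_ & Hu & Hv & Hl).
  pose proof (pu_ip _ _ _ u v Hl Hu Duv) as E.
  rewrite (pu_const_on _ _ 0 u v (sl_open Y HY) (fun s t d => proj1 (sl_orth Y HY s t d)) Duv) in E.
  unfold coefL; lra.
Qed.

Lemma coefM_nrm_v (Y : surface) (u v : R) :
  spacelike Y -> dom Y u v -> coefM Y u v = - ip (vpv (nrm Y) u v) (vpu (pos Y) u v).
Proof.
  intros HY Duv; destruct (spacelike_C1 Y HY) as (_ & Hu & Hv & Hl).
  pose proof (pv_ip _ _ _ u v Hl Hu Duv) as E.
  rewrite (pv_const_on _ _ 0 u v (sl_open Y HY) (fun s t d => proj1 (sl_orth Y HY s t d)) Duv) in E.
  unfold coefM; lra.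
Qed.

Lemma coefN_nrm (Y : surface) (u v : R) :
  spacelike Y -> dom Y u v -> coefN Y u v = - ip (vpv (nrm Y) u v) (vpv (pos Y) u v).
Proof.
  intros HY Duv; destruct (spacelike_C1 Y HY) as (_ & Hu & Hv & Hl).
  pose proof (pv_ip _ _ _ u v Hl Hv Duv) as E.
  rewrite (pv_const_on _ _ 0 u v (sl_open Y HY) (fun s t d => proj2 (sl_orth Y HY s t d)) Duv) in E.
  unfold coefN; lra.
Qed.

(** Here the mixed derivatives of the position vector have to be interchanged. *)
Lemma coefM_nrm_u (Y : surface) (u v : R) :
  spacelike Y -> dom Y u v -> coefM Y u v = - ip (vpu (nrm Y) u v) (vpv (pos Y) u v).
Proof.
  intros HY Duv; destruct (spacelike_C1 Y HY) as (_ & Hu & Hv & Hl).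
  pose proof (pu_ip _ _ _ u v Hl Hv Duv) as E.
  rewrite (pu_const_on _ _ 0 u v (sl_open Y HY) (fun s t d => proj2 (sl_orth Y HY s t d)) Duv) in E.
  assert (Ec : vpv (vpu (pos Y)) u v = vpu (vpv (pos Y)) u v).
  { destruct (sl_pos Y HY) as (P1 & P2 & P3).
    apply vec_eq; symmetry;
      [exact (pu_pv_comm _ _ u v (sl_open Y HY) P1 Duv)
      |exact (pu_pv_comm _ _ u v (sl_open Y HY) P2 Duv)
      |exact (pu_pv_comm _ _ u v (sl_open Y HY) P3 Duv)]. }
  unfold coefM; rewrite Ec; lra.
Qed.

Lemma nrm_derivatives_orth (Y : surface) (u v : R) :
  spacelike Y -> dom Y u v ->
  ip (vpu (nrm Y) u v) (nrm Y u v) = 0 /\ ip (vpv (nrm Y) u v) (nrm Y u v) = 0.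
Proof.
  intros HY Duv; destruct (spacelike_C1 Y HY) as (_ & _ & _ & Hl).
  pose proof (pu_ip _ _ _ u v Hl Hl Duv) as E1.
  pose proof (pv_ip _ _ _ u v Hl Hl Duv) as E2.
  rewrite (pu_const_on _ _ (-1) u v (sl_open Y HY) (sl_unit Y HY) Duv) in E1.
  rewrite (pv_const_on _ _ (-1) u v (sl_open Y HY) (sl_unit Y HY) Duv) in E2.
  rewrite (ip_comm (nrm Y u v)) in E1, E2; split; lra.
Qed.

Lemma principal_positive (Y : surface) (u v : R) :
  spacelike Y -> principal_parameters Y -> dom Y u v ->
  0 < coefE Y u v /\ 0 < coefG Y u v.
Proof.
  intros HY HP Duv; destruct (sl_metric Y HY u v Duv) as [HE HEG].
  rewrite (proj1 (HP u v Duv)) in HEG; split; auto.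
  apply (Rmult_lt_reg_l (coefE Y u v)); lra.
Qed.

Lemma vscal_opp_of_vadd_0 (k : R) (x y : vec) :
  vadd x (vscal k y) = (0, 0, 0) -> x = vscal (- k) y.
Proof.
  destruct x as [[x1 x2] x3], y as [[y1 y2] y3]; unfold vadd, vscal, c1, c2, c3; simpl.
  intros E; injection E as E1 E2 E3; repeat f_equal; lra.
Qed.

Lemma ip_add_l (x y z : vec) : ip (vadd x y) z = ip x z + ip y z.
Proof. unfold ip, vadd, c1, c2, c3; simpl; ring. Qed.

Lemma weingarten_equations (Y : surface) (u v : R) :
  spacelike Y -> principal_parameters Y -> dom Y u v ->
  vpu (nrm Y) u v = vscal (- nu1 Y u v) (vpu (pos Y) u v) /\
  vpv (nrm Y) u v = vscal (- nu2 Y u v) (vpv (pos Y) u v).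
Proof.
  intros HY HP Duv.
  destruct (principal_positive Y u v HY HP Duv) as [HE HG].
  destruct (HP u v Duv) as [HF HM].
  destruct (sl_orth Y HY u v Duv) as [Ou Ov].
  destruct (nrm_derivatives_orth Y u v HY Duv) as [Nu Nv].
  pose proof (coefL_nrm Y u v HY Duv) as EL. pose proof (coefN_nrm Y u v HY Duv) as EN.
  pose proof (coefM_nrm_u Y u v HY Duv) as EMu. pose proof (coefM_nrm_v Y u v HY Duv) as EMv.
  rewrite HM in EMu, EMv.
  split; apply vscal_opp_of_vadd_0;
    apply (ip_nondegenerate (vpu (pos Y) u v) (vpv (pos Y) u v) (nrm Y u v));
    auto; try now apply sl_unit.
  all: rewrite ip_add_l, ip_scal_l.
  - change (ip (vpu (pos Y) u v) (vpu (pos Y) u v)) with (coefE Y u v).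
    unfold nu1; rewrite EL; field; lra.
  - change (ip (vpu (pos Y) u v) (vpv (pos Y) u v)) with (coefF Y u v).
    rewrite HF; lra.
  - rewrite Nu, (ip_comm (vpu (pos Y) u v)), Ou; ring.
  - rewrite (ip_comm (vpv (pos Y) u v)).
    change (ip (vpu (pos Y) u v) (vpv (pos Y) u v)) with (coefF Y u v).
    rewrite HF; lra.
  - change (ip (vpv (pos Y) u v) (vpv (pos Y) u v)) with (coefG Y u v).
    unfold nu2; rewrite EN; field; lra.
  - rewrite Nv, (ip_comm (vpv (pos Y) u v)), Ov; ring.
Qed.

(** Converse: Weingarten equations in orthogonal parameters determine the
    second fundamental form. *)
Lemma curvatures_of_weingarten (Y : surface) (u v k1 k2 : R) :
  spacelike Y -> dom Y u v -> coefF Y u v = 0 ->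
  vpu (nrm Y) u v = vscal (- k1) (vpu (pos Y) u v) ->
  vpv (nrm Y) u v = vscal (- k2) (vpv (pos Y) u v) ->
  coefM Y u v = 0 /\ nu1 Y u v = k1 /\ nu2 Y u v = k2.
Proof.
  intros HY Duv HF Eu Ev.
  destruct (sl_metric Y HY u v Duv) as [HE HEG].
  assert (HG : coefG Y u v <> 0).
  { intros HG; rewrite HF, HG in HEG; lra. }
  unfold nu1, nu2.
  rewrite (coefL_nrm Y u v HY Duv), (coefN_nrm Y u v HY Duv), (coefM_nrm_u Y u v HY Duv).
  rewrite Eu, Ev, !ip_scal_l; fold (coefE Y u v) (coefF Y u v) (coefG Y u v).
  rewrite HF; repeat split; [ring|field; lra|field; lra].
Qed.

(** * Parallel surfaces *)

(** A part [X'] of the parallel surface at distance [a] on which the sign of the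
    unit normal is the constant [e]. *)
Record parallel_piece (a e : R) (X X' : surface) : Prop := {
  pl_open : open2 (dom X');
  pl_dom : forall u v, dom X' u v -> dom X u v;
  pl_pos : forall u v, pos X' u v = vadd (pos X u v) (vscal a (nrm X u v));
  pl_nrm : forall u v, dom X' u v -> nrm X' u v = vscal e (nrm X u v)
}.

Lemma componentwise_impl (P Q : (R -> R -> R) -> Prop) (x : R -> R -> vec) :
  (forall h, P h -> Q h) -> componentwise P x -> componentwise Q x.
Proof. intros H (A & B & C); exact (conj (H _ A) (conj (H _ B) (H _ C))). Qed.

Lemma componentwise_C1_ext (D : R -> R -> Prop) (x y : R -> R -> vec) :
  open2 D -> (forall s t, D s t -> x s t = y s t) ->
  componentwise (C1_on D) x -> componentwise (C1_on D) y.
Proof.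
  intros HD E (A & B & C); split; [|split].
  - apply (C1_on_ext D (fun u v => c1 (x u v))); auto; intros s t d; now rewrite E.
  - apply (C1_on_ext D (fun u v => c2 (x u v))); auto; intros s t d; now rewrite E.
  - apply (C1_on_ext D (fun u v => c3 (x u v))); auto; intros s t d; now rewrite E.
Qed.

Lemma componentwise_C1_scal (D : R -> R -> Prop) (k : R -> R -> R) (x : R -> R -> vec) :
  open2 D -> C1_on D k -> componentwise (C1_on D) x ->
  componentwise (C1_on D) (fun u v => vscal (k u v) (x u v)).
Proof.
  intros HD Hk (A & B & C); split; [|split].
  - exact (C1_on_mult D _ _ HD Hk A).
  - exact (C1_on_mult D _ _ HD Hk B).
  - exact (C1_on_mult D _ _ HD Hk C).
Qed.

Lemma componentwise_C1_add (D : R -> R -> Prop) (x y : R -> R -> vec) :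
  open2 D -> componentwise (C1_on D) x -> componentwise (C1_on D) y ->
  componentwise (C1_on D) (fun u v => vadd (x u v) (y u v)).
Proof.
  intros HD (A & B & C) (A' & B' & C'); split; [|split].
  - exact (C1_on_plus D _ _ HD A A').
  - exact (C1_on_plus D _ _ HD B B').
  - exact (C1_on_plus D _ _ HD C C').
Qed.

Lemma componentwise_C1_C2 (D : R -> R -> Prop) (x : R -> R -> vec) :
  componentwise (C1_on D) x -> componentwise (C1_on D) (vpu x) ->
  componentwise (C1_on D) (vpv x) -> componentwise (C2_on D) x.
Proof.
  intros (A & B & C) (Au & Bu & Cu) (Av & Bv & Cv).
  exact (conj (conj A (conj Au Av)) (conj (conj B (conj Bu Bv)) (conj C (conj Cu Cv)))).
Qed.

(** Both coordinate directions are stretched, by [1 - a nu1] and [1 - a nu2]. *)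
Lemma parallel_piece_tangents (a e : R) (X X' : surface) (u v : R) :
  spacelike X -> principal_parameters X -> parallel_piece a e X X' -> dom X' u v ->
  vpu (pos X') u v = vscal (1 - a * nu1 X u v) (vpu (pos X) u v) /\
  vpv (pos X') u v = vscal (1 - a * nu2 X u v) (vpv (pos X) u v).
Proof.
  intros HX HP HX' Duv.
  pose proof (pl_dom _ _ _ _ HX' u v Duv) as Dx.
  destruct (spacelike_C1 X HX) as (Hz & _ & _ & Hl).
  destruct (weingarten_equations X u v HX HP Dx) as [Wu Wv].
  rewrite (vpu_ext_on _ _ _ u v (pl_open _ _ _ _ HX') (fun s t _ => pl_pos _ _ _ _ HX' s t) Duv).
  rewrite (vpv_ext_on _ _ _ u v (pl_open _ _ _ _ HX') (fun s t _ => pl_pos _ _ _ _ HX' s t) Duv).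
  rewrite (vpu_add_scal (dom X)), (vpv_add_scal (dom X)), Wu, Wv by auto.
  split; apply vec_eq; unfold vadd, vscal, c1, c2, c3; simpl; ring.
Qed.

Lemma parallel_piece_spacelike (K : R -> Prop) (a e : R) (f g fb gb : R -> R)
    (nu : R -> R -> R) (X X' : surface) :
  spacelike X -> principal_parameters X -> parallel_piece a e X X' ->
  parallel_pair K a e f g fb gb -> C1_on (dom X) nu ->
  (forall u v, dom X' u v -> K (nu u v)) ->
  (forall u v, dom X u v -> nu1 X u v = f (nu u v)) ->
  (forall u v, dom X u v -> nu2 X u v = g (nu u v)) ->
  spacelike X'.
Proof.
  intros HX HP HX' Hpp Hnu HK H1 H2.
  pose proof (pl_open _ _ _ _ HX') as HD.
  pose proof (pl_dom _ _ _ _ HX') as Hsub.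
  pose proof (C1_on_subset _ _ _ Hsub Hnu) as Hnu'.
  destruct (spacelike_C1 X HX) as (Cz & Cu & Cv & Cl).
  apply (componentwise_impl _ _ _ (fun h => C1_on_subset _ (dom X') h Hsub))
    in Cz, Cu, Cv, Cl.
  assert (Cfac : forall h, C2_fun_on K h -> C1_on (dom X') (fun u v => 1 + - a * h (nu u v))).
  { intros h Hh.
    apply (C1_on_plus _ (fun _ _ => 1) (fun u v => - a * h (nu u v))); auto.
    - apply C1_on_const.
    - apply (C1_on_mult _ (fun _ _ => - a) (fun u v => h (nu u v))); auto.
      + apply C1_on_const.
      + now apply (C1_on_comp _ K). }
  assert (Tu : forall u v, dom X' u v ->
            vscal (1 + - a * f (nu u v)) (vpu (pos X) u v) = vpu (pos X') u v).
  { intros u v Duv; rewrite (proj1 (parallel_piece_tangents a e X X' u v HX HP HX' Duv)).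
    rewrite H1 by auto; f_equal; ring. }
  assert (Tv : forall u v, dom X' u v ->
            vscal (1 + - a * g (nu u v)) (vpv (pos X) u v) = vpv (pos X') u v).
  { intros u v Duv; rewrite (proj2 (parallel_piece_tangents a e X X' u v HX HP HX' Duv)).
    rewrite H2 by auto; f_equal; ring. }
  split; auto.
  - (* The tangent vectors show that the normal, a priori of class C^1, leads
       to a position vector of class C^2. *)
    apply componentwise_C1_C2.
    + apply (componentwise_C1_ext _ (fun u v => vadd (pos X u v) (vscal a (nrm X u v)))); auto.
      { intros s t _; symmetry; apply (pl_pos _ _ _ _ HX'). }
      apply componentwise_C1_add; auto.
      apply (componentwise_C1_scal _ (fun _ _ => a)); auto; apply C1_on_const.
    + apply (componentwise_C1_ext _
        (fun u v => vscal (1 + - a * f (nu u v)) (vpu (pos X) u v))); auto.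
      apply (componentwise_C1_scal _ (fun u v => 1 + - a * f (nu u v))); auto.
      apply Cfac, (pp_f _ _ _ _ _ _ _ Hpp).
    + apply (componentwise_C1_ext _
        (fun u v => vscal (1 + - a * g (nu u v)) (vpv (pos X) u v))); auto.
      apply (componentwise_C1_scal _ (fun u v => 1 + - a * g (nu u v))); auto.
      apply Cfac, (pp_g _ _ _ _ _ _ _ Hpp).
  - intros u v Duv.
    destruct (principal_positive X u v HX HP (Hsub u v Duv)) as [HE HG].
    pose proof (pp_nzf _ _ _ _ _ _ _ Hpp _ (HK u v Duv)) as Nf.
    pose proof (pp_nzg _ _ _ _ _ _ _ Hpp _ (HK u v Duv)) as Ng.
    unfold coefE, coefF, coefG; rewrite <- Tu, <- Tv by auto.
    rewrite !ip_scal_l, !ip_scal_r; fold (coefE X u v) (coefF X u v) (coefG X u v).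
    rewrite (proj1 (HP u v (Hsub u v Duv))).
    set (p := 1 + - a * f (nu u v)); set (q := 1 + - a * g (nu u v)).
    assert (Hp : 0 < p * p) by (apply Rsqr_pos_lt; unfold p; lra).
    assert (Hq : 0 < q * q) by (apply Rsqr_pos_lt; unfold q; lra).
    pose proof (Rmult_lt_0_compat _ _ Hp HE) as Pp.
    pose proof (Rmult_lt_0_compat _ _ Hq HG) as Pq.
    pose proof (Rmult_lt_0_compat _ _ Pp Pq) as Ppq.
    split; nra.
  - apply (componentwise_C1_ext _ (fun u v => vscal e (nrm X u v))); auto.
    { intros s t d; symmetry; now apply (pl_nrm _ _ _ _ HX'). }
    apply (componentwise_C1_scal _ (fun _ _ => e)); auto; apply C1_on_const.
  - intros u v Duv; destruct (sl_orth X HX u v (Hsub u v Duv)) as [Ou Ov].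
    rewrite (pl_nrm _ _ _ _ HX' u v Duv), <- Tu, <- Tv by auto.
    rewrite !ip_scal_l, !ip_scal_r, Ou, Ov; split; ring.
  - intros u v Duv.
    rewrite (pl_nrm _ _ _ _ HX' u v Duv), ip_scal_l, ip_scal_r, (sl_unit X HX) by auto.
    pose proof (pp_sign _ _ _ _ _ _ _ Hpp); lra.
Qed.

Lemma parallel_piece_metric (a e : R) (X X' : surface) (u v : R) :
  spacelike X -> principal_parameters X -> parallel_piece a e X X' -> dom X' u v ->
  coefE X' u v = (1 - a * nu1 X u v) ^ 2 * coefE X u v /\ coefF X' u v = 0 /\
  coefG X' u v = (1 - a * nu2 X u v) ^ 2 * coefG X u v.
Proof.
  intros HX HP HX' Duv.
  destruct (parallel_piece_tangents a e X X' u v HX HP HX' Duv) as [Tu Tv].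
  unfold coefE, coefF, coefG; rewrite Tu, Tv, !ip_scal_l, !ip_scal_r.
  fold (coefF X u v); rewrite (proj1 (HP u v (pl_dom _ _ _ _ HX' u v Duv))).
  repeat split; ring.
Qed.

Lemma parallel_piece_W_surface (a e : R) (X X' : surface) (W W' : weingarten) :
  W_surface X W -> parallel_piece a e X X' ->
  parallel_pair (itv W') a e (wf W) (wg W) (wf W') (wg W') ->
  wnu W' = wnu W -> (forall t, itv W' t -> itv W t) ->
  (forall u v, dom X' u v -> itv W' (wnu W u v)) ->
  W_surface X' W'.
Proof.
  intros HW HX' Hpp Enu Hitv HK.
  pose proof (ws_spacelike X W HW) as HX; pose proof (ws_principal X W HW) as HP.
  pose proof (pl_dom _ _ _ _ HX') as Hsub.
  assert (Hsl : spacelike X').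
  { apply (parallel_piece_spacelike (itv W') a e (wf W) (wg W) (wf W') (wg W') (wnu W) X); auto.
    - apply (ws_nu X W HW).
    - apply (ws_nu1 X W HW).
    - apply (ws_nu2 X W HW). }
  assert (Hc : forall u v, dom X' u v ->
            coefM X' u v = 0 /\ nu1 X' u v = wf W' (wnu W u v)
            /\ nu2 X' u v = wg W' (wnu W u v)).
  { intros u v Duv; pose proof (Hsub u v Duv) as Dx.
    destruct (parallel_piece_tangents a e X X' u v HX HP HX' Duv) as [Tu Tv].
    destruct (weingarten_equations X u v HX HP Dx) as [Wu Wv].
    rewrite (ws_nu1 X W HW) in Tu, Wu by auto. rewrite (ws_nu2 X W HW) in Tv, Wv by auto.
    pose proof (pp_nzf _ _ _ _ _ _ _ Hpp _ (HK u v Duv)) as Nf.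
    pose proof (pp_nzg _ _ _ _ _ _ _ Hpp _ (HK u v Duv)) as Ng.
    apply curvatures_of_weingarten; auto.
    - apply (parallel_piece_metric a e X X' u v HX HP HX' Duv).
    - rewrite (vpu_ext_on _ _ _ u v (pl_open _ _ _ _ HX') (pl_nrm _ _ _ _ HX') Duv).
      rewrite vpu_scal_const, Wu, Tu, (pp_fb _ _ _ _ _ _ _ Hpp) by auto.
      apply vec_eq; unfold vscal, c1, c2, c3; simpl; field; auto.
    - rewrite (vpv_ext_on _ _ _ u v (pl_open _ _ _ _ HX') (pl_nrm _ _ _ _ HX') Duv).
      rewrite vpv_scal_const, Wv, Tv, (pp_gb _ _ _ _ _ _ _ Hpp) by auto.
      apply vec_eq; unfold vscal, c1, c2, c3; simpl; field; auto. }
  split; auto.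
  - intros u v Duv; split; [|now apply Hc].
    apply (parallel_piece_metric a e X X' u v HX HP HX' Duv).
  - apply (pp_itv _ _ _ _ _ _ _ Hpp).
  - now apply (C2_fun_parallel _ a e (wf W) (wg W) (wf W') (wg W')).
  - apply (C2_fun_parallel _ a e (wg W) (wf W) (wg W') (wf W')).
    now apply parallel_pair_swap.
  - intros t Kt.
    rewrite (Derive_parallel _ _ _ _ _ _ _ t Hpp Kt).
    rewrite (Derive_parallel _ _ _ _ _ _ _ t (parallel_pair_swap _ _ _ _ _ _ _ Hpp) Kt).
    pose proof (pp_nzf _ _ _ _ _ _ _ Hpp _ Kt) as Nf.
    pose proof (pp_nzg _ _ _ _ _ _ _ Hpp _ Kt) as Ng.
    pose proof (sqr_one_neq_0 e (pp_sign _ _ _ _ _ _ _ Hpp)) as Ne.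
    destruct (Rmult_neq_0_reg _ _ (ws_fg' X W HW t (Hitv t Kt))) as [Ndf Ndg].
    replace (_ * _) with (e * e * (Derive (wf W) t * Derive (wg W) t)
       * / ((1 - a * wf W t) ^ 2 * (1 - a * wg W t) ^ 2)) by (field; auto).
    repeat (apply Rmult_integral_contrapositive; split); auto.
    apply Rinv_neq_0_compat, Rmult_integral_contrapositive; split; now apply pow_nonzero.
  - intros t Kt; now apply (parallel_diff_neq_0 _ _ _ _ _ _ _ t Hpp).
  - rewrite Enu; apply (C2_on_subset (dom X)); auto; apply (ws_nu X W HW).
  - rewrite Enu; auto.
  - intros u v Duv; rewrite Enu; now apply Hc.
  - intros u v Duv; rewrite Enu; now apply Hc.
Qed.

(** * Natural parameters and the kind of a surface *)

Lemma Derive_of_sqrt_exp_const (h w : R -> R) (c s dw : R) :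
  locally s (fun r => 0 < h r /\ sqrt (h r) * exp (w r) = c) -> is_derive w s dw ->
  Derive h s = - 2 * h s * dw.
Proof.
  intros Hloc Hw.
  assert (E : forall r, 0 < h r /\ sqrt (h r) * exp (w r) = c ->
            c ^ 2 * exp (- 2 * w r) = h r).
  { intros r [Hr <-].
    replace (_ * _) with (sqrt (h r) * sqrt (h r) * (exp (w r) * exp (w r) * exp (- 2 * w r)))
      by ring.
    rewrite <- !exp_plus, sqrt_sqrt by lra.
    replace (w r + w r + - 2 * w r) with 0 by ring; rewrite exp_0; ring. }
  rewrite <- (Derive_ext_loc _ _ s (filter_imp _ _ E Hloc)).
  rewrite <- (E s (locally_singleton s _ Hloc)).
  apply is_derive_unique; auto_derive; [eexists; eauto|].
  change (Derive (fun x : R => w x) s) with (Derive w s).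
  rewrite (is_derive_unique _ _ _ Hw); ring.
Qed.

Lemma Rmult_eq_0_iff (k x : R) : k <> 0 -> (k * x = 0 <-> x = 0).
Proof.
  intros Hk; split; [|intros ->; ring].
  intros E; now destruct (Rmult_integral _ _ E).
Qed.

(** In natural parameters [gamma1] is a nowhere vanishing multiple of [nu_v]:
    the logarithmic derivative of [E] is [-2 I_v]. *)
Lemma gamma1_eq_0_iff (X : surface) (W : weingarten) (u0 v0 u v : R) :
  W_surface X W -> dom X u0 v0 -> natural_parameters X W u0 v0 -> dom X u v ->
  (gamma1 X u v = 0 <-> pv (wnu W) u v = 0).
Proof.
  intros HW D0 [[c Hc] _] Duv.
  pose proof (ws_spacelike X W HW) as HX; pose proof (ws_principal X W HW) as HP.
  destruct (principal_positive X u v HX HP Duv) as [HE HG].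
  pose proof (ws_range X W HW u v Duv) as Kt; pose proof (ws_range X W HW u0 v0 D0) as K0.
  set (t := wnu W u v) in *; set (t0 := wnu W u0 v0) in *.
  assert (Ed : pv (coefE X) u v = - 2 * coefE X u v *
             (pv (wnu W) u v * (Derive (wf W) t / (wf W t - wg W t)))).
  { apply (Derive_of_sqrt_exp_const (fun s => coefE X u s)
             (fun s => wint (wf W) (wg W) t0 (wnu W u s)) c).
    - apply (open2_locally_v (dom X) (fun s t => 0 < coefE X s t /\
        sqrt (coefE X s t) * exp (wint (wf W) (wg W) t0 (wnu W s t)) = c)); auto.
      { apply HX. }
      intros s r Dsr; split; [now apply (principal_positive X s r HX HP)|now apply Hc].
    - apply (is_derive_comp (wint (wf W) (wg W) t0) (fun s => wnu W u s)).
      + apply (is_derive_wint (itv W)); auto; apply HW.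
      + apply Derive_correct, (proj1 (ws_nu X W HW) u v Duv). }
  set (k := Derive (wf W) t / (wf W t - wg W t) / sqrt (coefG X u v)).
  assert (Hk : k <> 0).
  { pose proof (ws_fg' X W HW t Kt) as Nd; pose proof (ws_fg X W HW t Kt) as Ns.
    pose proof (sqrt_lt_R0 _ HG).
    repeat (apply Rmult_integral_contrapositive; split);
      try (apply Rinv_neq_0_compat; lra).
    intros E; apply Nd; rewrite E; ring. }
  replace (gamma1 X u v) with (k * pv (wnu W) u v).
  - now apply Rmult_eq_0_iff.
  - unfold gamma1, k; rewrite Ed.
    pose proof (ws_fg X W HW t Kt); pose proof (sqrt_lt_R0 _ HG).
    field; repeat split; lra.
Qed.

Lemma gamma2_eq_0_iff (X : surface) (W : weingarten) (u0 v0 u v : R) :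
  W_surface X W -> dom X u0 v0 -> natural_parameters X W u0 v0 -> dom X u v ->
  (gamma2 X u v = 0 <-> pu (wnu W) u v = 0).
Proof.
  intros HW D0 [_ [c Hc]] Duv.
  pose proof (ws_spacelike X W HW) as HX; pose proof (ws_principal X W HW) as HP.
  destruct (principal_positive X u v HX HP Duv) as [HE HG].
  pose proof (ws_range X W HW u v Duv) as Kt; pose proof (ws_range X W HW u0 v0 D0) as K0.
  set (t := wnu W u v) in *; set (t0 := wnu W u0 v0) in *.
  assert (Hsep : forall s, itv W s -> wg W s - wf W s <> 0).
  { intros s Ks; pose proof (ws_fg X W HW s Ks); lra. }
  assert (Ed : pu (coefG X) u v = - 2 * coefG X u v *
             (pu (wnu W) u v * (Derive (wg W) t / (wg W t - wf W t)))).
  { apply (Derive_of_sqrt_exp_const (fun s => coefG X s v)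
             (fun s => wint (wg W) (wf W) t0 (wnu W s v)) c).
    - apply (open2_locally_u (dom X) (fun s t => 0 < coefG X s t /\
        sqrt (coefG X s t) * exp (wint (wg W) (wf W) t0 (wnu W s t)) = c)); auto.
      { apply HX. }
      intros s r Dsr; split; [now apply (principal_positive X s r HX HP)|now apply Hc].
    - apply (is_derive_comp (wint (wg W) (wf W) t0) (fun s => wnu W s v)).
      + apply (is_derive_wint (itv W)); auto; apply HW.
      + apply Derive_correct, (proj1 (ws_nu X W HW) u v Duv). }
  set (k := - (Derive (wg W) t / (wg W t - wf W t)) / sqrt (coefE X u v)).
  pose proof (sqrt_lt_R0 _ HE). pose proof (Hsep t Kt) as Ns.
  assert (Hk : k <> 0).
  { pose proof (ws_fg' X W HW t Kt) as Nd.
    apply Rmult_integral_contrapositive; split; [apply Ropp_neq_0_compat|];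
    repeat (apply Rmult_integral_contrapositive; split);
      try (apply Rinv_neq_0_compat; lra).
    intros E; apply Nd; rewrite E; ring. }
  replace (gamma2 X u v) with (k * pu (wnu W) u v).
  - now apply Rmult_eq_0_iff.
  - unfold gamma2, k; rewrite Ed. field; repeat split; lra.
Qed.

(** The kind of a surface in natural parameters is a property of [nu] alone, so
    that it passes to the parallel surface. *)
Lemma of_kind_iff (k : kind) (X : surface) (W : weingarten) (u0 v0 : R) :
  W_surface X W -> dom X u0 v0 -> natural_parameters X W u0 v0 ->
  (of_kind k X <->
   forall u v, dom X u v -> pu (wnu W) u v <> 0 /\
     match k with
     | StronglyRegular => pv (wnu W) u v <> 0
     | Gamma1Zero => pv (wnu W) u v = 0
     end).
Proof.
  intros HW D0 HN.
  assert (Hd : forall u v, dom X u v -> nu1 X u v - nu2 X u v <> 0).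
  { intros u v Duv; rewrite (ws_nu1 X W HW), (ws_nu2 X W HW) by auto.
    apply (ws_fg X W HW), (ws_range X W HW); auto. }
  destruct k; simpl; split; intros H u v Duv; specialize (H u v Duv);
    pose proof (Hd u v Duv) as Nd;
    destruct (gamma1_eq_0_iff X W u0 v0 u v HW D0 HN Duv) as [G1 G1'];
    destruct (gamma2_eq_0_iff X W u0 v0 u v HW D0 HN Duv) as [G2 G2'].
  - split; intros E; apply H; [rewrite (G2' E)|rewrite (G1' E)]; ring.
  - intros E; destruct (Rmult_integral _ _ E) as [E'|E'];
      [destruct (Rmult_integral _ _ E')|]; tauto.
  - destruct H as [H1 H2]; split; [|tauto].
    intros E; apply H2; rewrite (G2' E); ring.
  - split; [tauto|]. intros E; destruct (Rmult_integral _ _ E); tauto.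
Qed.

Lemma sqrt_exp_parallel (E I Ib p p0 : R) :
  0 < E -> exp (2 * Ib) * p ^ 2 = exp (2 * I) * p0 ^ 2 ->
  sqrt (p ^ 2 * E) * exp Ib = sqrt E * exp I * Rabs p0.
Proof.
  intros HE H.
  assert (Hx : forall x, exp (2 * x) = exp x * exp x).
  { intros x; rewrite <- exp_plus; f_equal; ring. }
  rewrite !Hx in H.
  pose proof (exp_pos I); pose proof (exp_pos Ib); pose proof (sqrt_lt_R0 _ HE).
  rewrite sqrt_mult_alt by apply pow2_ge_0.
  rewrite <- (Rsqr_pow2 p), sqrt_Rsqr_abs.
  assert (HA : Rabs p * exp Ib = Rabs p0 * exp I).
  { rewrite <- (Rabs_pos_eq (exp Ib)), <- (Rabs_pos_eq (exp I)), <- !Rabs_mult by lra.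
    apply Rsqr_eq_abs_0; unfold Rsqr; lra. }
  transitivity (sqrt E * (Rabs p * exp Ib)); [ring|rewrite HA; ring].
Qed.

Lemma parallel_piece_natural (a e u0 v0 : R) (X X' : surface) (W W' : weingarten) :
  W_surface X W -> parallel_piece a e X X' ->
  parallel_pair (itv W') a e (wf W) (wg W) (wf W') (wg W') ->
  wnu W' = wnu W -> (forall u v, dom X' u v -> itv W' (wnu W u v)) -> dom X' u0 v0 ->
  natural_parameters X W u0 v0 -> natural_parameters X' W' u0 v0.
Proof.
  intros HW HX' Hpp Enu HK D0 [[c Hc] [d Hd]].
  pose proof (ws_spacelike X W HW) as HX; pose proof (ws_principal X W HW) as HP.
  pose proof (pl_dom _ _ _ _ HX') as Hsub.
  unfold natural_parameters; rewrite Enu; split.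
  - exists (c * Rabs (1 - a * wf W (wnu W u0 v0))).
    intros u v Duv; rewrite <- (Hc u v) by auto.
    rewrite (proj1 (parallel_piece_metric a e X X' u v HX HP HX' Duv)).
    rewrite (ws_nu1 X W HW) by auto.
    apply sqrt_exp_parallel; [apply (principal_positive X u v HX HP (Hsub u v Duv))|].
    apply (exp_wint_parallel _ _ _ _ _ _ _ _ _ Hpp); auto.
  - exists (d * Rabs (1 - a * wg W (wnu W u0 v0))).
    intros u v Duv; rewrite <- (Hd u v) by auto.
    rewrite (proj2 (proj2 (parallel_piece_metric a e X X' u v HX HP HX' Duv))).
    rewrite (ws_nu2 X W HW) by auto.
    apply sqrt_exp_parallel; [apply (principal_positive X u v HX HP (Hsub u v Duv))|].
    apply (exp_wint_parallel _ _ _ _ _ _ _ _ _ (parallel_pair_swap _ _ _ _ _ _ _ Hpp)); auto.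
Qed.

(** * The natural PDE of the parallel surface *)

Lemma same_sign_of_neq_0 (h : R -> R) (x y : R) :
  (forall s, Rmin x y <= s <= Rmax x y -> continuous h s /\ h s <> 0) ->
  sign (h x) = sign (h y).
Proof.
  assert (Hlt : forall x y, x < y ->
            (forall s, x <= s <= y -> continuous h s /\ h s <> 0) ->
            0 < h x * h y).
  { clear x y; intros x y Hxy H.
    destruct (Rlt_dec 0 (h x * h y)) as [|Hn]; [assumption|exfalso].
    assert (Hc : forall k s, x <= s <= y -> continuity_pt (fun r => k * h r) s).
    { intros k s Hs; apply continuity_pt_filterlim.
      apply (continuous_mult (fun _ => k) h); [apply continuous_const|now apply H]. }
    destruct (H x) as [_ Hx]; [lra|]. destruct (H y) as [_ Hy]; [lra|].
    destruct (Ranalysis5.IVT_interv (fun r => - h x * h r) x y) as [z [Hz Ez]]; auto.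
    - pose proof (Rsqr_pos_lt _ Hx); unfold Rsqr in *; lra.
    - assert (h x * h y <> 0) by now apply Rmult_integral_contrapositive.
      lra.
    - destruct (Rmult_integral _ _ Ez) as [E|E]; [apply Hx; lra|].
      now apply (proj2 (H z Hz)). }
  assert (Hs : forall p q, 0 < p * q -> sign p = sign q).
  { intros p q Hpq; destruct (Rtotal_order p 0) as [Hp|[->|Hp]]; [|lra|].
    - rewrite !sign_eq_m1; auto; nra.
    - rewrite !sign_eq_1; auto; nra. }
  intros H; destruct (Rtotal_order x y) as [L|[->|L]]; [|reflexivity|].
  - rewrite Rmin_left, Rmax_right in H by lra; now apply Hs, Hlt.
  - rewrite Rmin_right, Rmax_left in H by lra; symmetry; now apply Hs, Hlt.
Qed.

Lemma sign_sqr (x : R) : x <> 0 -> sign x * sign x = 1.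
Proof.
  intros Hx; destruct (Rtotal_order x 0) as [H|[H|H]]; [|easy|].
  - rewrite sign_eq_m1 by auto; ring.
  - rewrite sign_eq_1 by auto; ring.
Qed.

(** The interval of the barred functions: the points of [K] that a segment free
    of zeros of [d] joins to [t0]. *)
Lemma zero_free_open_interval (K : R -> Prop) (d : R -> R) (t0 : R) :
  open_interval K -> (forall t, K t -> continuous d t) ->
  open_interval (fun t => K t /\ forall s, Rmin t0 t <= s <= Rmax t0 t -> d s <> 0).
Proof.
  intros HK Hc; split.
  - intros t [Kt Ht].
    assert (Hdt : d t <> 0).
    { apply Ht; unfold Rmin, Rmax; destruct (Rle_dec t0 t); lra. }
    destruct (proj1 HK t Kt) as [e1 H1].
    assert (Hnb : locally t (fun s => d s <> 0)).
    { apply (Hc t Kt (fun y => y <> 0)).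
      exists (mkposreal _ (Rabs_pos_lt _ Hdt)); simpl.
      intros y Hy E; rewrite E in Hy; unfold ball in Hy; simpl in Hy.
      unfold AbsRing_ball, abs, minus, plus, opp in Hy; simpl in Hy.
      rewrite Rplus_0_l, Rabs_Ropp in Hy; lra. }
    destruct Hnb as [e2 H2].
    assert (Hball : forall e r, Rabs (r - t) < e -> @ball R_UniformSpace t e r)
      by (intros; assumption).
    exists (mkposreal _ (Rmin_pos e1 e2 (cond_pos e1) (cond_pos e2))).
    intros s Hs. assert (Hs' : Rabs (s - t) < Rmin e1 e2) by exact Hs.
    pose proof (Rmin_l e1 e2); pose proof (Rmin_r e1 e2).
    split; [apply H1, Hball; lra|].
    intros r Hr.
    destruct (Rlt_dec (Rabs (r - t)) e2) as [L|L]; [now apply H2, Hball|].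
    apply Ht.
    revert Hr L Hs'; unfold Rmin at 1, Rmax at 1, Rabs;
      unfold Rmin at 2, Rmax.
    destruct (Rle_dec t0 s), (Rle_dec t0 t), (Rcase_abs (r - t)), (Rcase_abs (s - t)); lra.
  - intros x y s [Kx Hx] [Ky Hy] Hs; split; [now apply (proj2 HK x y)|].
    intros r Hr.
    assert (Hor : Rmin t0 x <= r <= Rmax t0 x \/ Rmin t0 y <= r <= Rmax t0 y).
    { revert Hr; unfold Rmin, Rmax.
      destruct (Rle_dec t0 s), (Rle_dec t0 x), (Rle_dec t0 y); lra. }
    destruct Hor; auto.
Qed.

(** On the interval of the barred functions the sign is constant, by the
    intermediate value theorem. *)
Lemma parallel_weingarten_pair (a t0 : R) (W : weingarten) :
  let W' := parallel_weingarten a W t0 in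
  let d := fun t => (1 - a * wf W t) * (1 - a * wg W t) in
  open_interval (itv W) -> C2_fun_on (itv W) (wf W) -> C2_fun_on (itv W) (wg W) ->
  (forall t, itv W t -> wf W t - wg W t <> 0) -> itv W t0 -> d t0 <> 0 ->
  parallel_pair (itv W') a (sign (d t0)) (wf W) (wg W) (wf W') (wg W').
Proof.
  intros W' d HK Hf Hg Hsep K0 Hd0.
  assert (Hc : forall t, itv W t -> continuous d t).
  { intros t Kt; apply (ex_derive_continuous d).
    pose proof (proj1 (Hf t Kt)); pose proof (proj1 (Hg t Kt)).
    unfold d; auto_derive; auto. }
  assert (Hnz : forall t, itv W' t -> d t <> 0).
  { intros t [Kt Ht]; apply Ht; unfold Rmin, Rmax; destruct (Rle_dec t0 t); lra. }
  assert (Hsg : forall t, itv W' t -> sign (d t) = sign (d t0)).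
  { intros t [Kt Ht]; symmetry; apply same_sign_of_neq_0.
    intros s Hs; split; [|now apply Ht].
    apply Hc; now apply (open_interval_between (itv W) t0 t). }
  split.
  - now apply (zero_free_open_interval (itv W) d t0).
  - intros t [Kt _]; now apply Hf.
  - intros t [Kt _]; now apply Hg.
  - intros t [Kt _]; now apply Hsep.
  - intros t Kt E; apply (Hnz t Kt); unfold d; rewrite E; ring.
  - intros t Kt E; apply (Hnz t Kt); unfold d; rewrite E; ring.
  - now apply sign_sqr.
  - intros t Kt; rewrite <- (Hsg t Kt); reflexivity.
  - intros t Kt; rewrite <- (Hsg t Kt); reflexivity.
Qed.

(** Both sides of the equation are divided by [(1 - a f) (1 - a g)]. *)
Lemma natural_PDE_parallel (k : kind) (a e t0 aa bb aa' bb' : R) (W W' : weingarten) :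
  parallel_pair (itv W') a e (wf W) (wg W) (wf W') (wg W') -> itv W' t0 ->
  0 < aa -> 0 < bb -> 0 < aa' -> 0 < bb' ->
  / aa' ^ 2 = / aa ^ 2 * (1 - a * wf W t0) ^ 2 ->
  / bb' ^ 2 = / bb ^ 2 * (1 - a * wg W t0) ^ 2 ->
  same_equation (itv W') (natural_PDE k W t0 aa bb) (natural_PDE k W' t0 aa' bb').
Proof.
  intros Hpp K0 Ha Hb Ha' Hb' Ea Eb U om HU [Hom [Homu Homv]] HK u v Duv.
  pose proof (natural_term_parallel _ _ _ _ _ _ _ t0 aa aa' (fun s => om s v) u Hpp K0 Ha Ha' Ea)
    as HUt.
  pose proof (natural_term_parallel _ _ _ _ _ _ _ t0 bb bb' (fun t => om u t) v
    (parallel_pair_swap _ _ _ _ _ _ _ Hpp) K0 Hb Hb' Eb) as HVt.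
  specialize (HUt (open2_locally_u U (fun s t => itv W' (om s t) /\ ex_derive (fun r => om r t) s)
    u v HU Duv (fun s t d => conj (HK s t d) (proj1 (Hom s t d))))
    (proj1 (Homu u v Duv))).
  specialize (HVt (open2_locally_v U (fun s t => itv W' (om s t) /\ ex_derive (fun r => om s r) t)
    u v HU Duv (fun s t d => conj (HK s t d) (proj1 (proj2 (Hom s t d)))))
    (proj1 (proj2 (Homv u v Duv)))).
  pose proof (pp_nzf _ _ _ _ _ _ _ Hpp _ (HK u v Duv)) as Nf.
  pose proof (pp_nzg _ _ _ _ _ _ _ Hpp _ (HK u v Duv)) as Ng.
  pose proof (pp_sign _ _ _ _ _ _ _ Hpp) as He.
  set (p := (1 - a * wf W (om u v)) * (1 - a * wg W (om u v))) in *.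
  assert (Np : p <> 0) by now apply Rmult_integral_contrapositive.
  assert (Er : - (wf W' (om u v) * wg W' (om u v)) = - (wf W (om u v) * wg W (om u v)) / p).
  { rewrite (pp_fb _ _ _ _ _ _ _ Hpp), (pp_gb _ _ _ _ _ _ _ Hpp) by auto.
    transitivity (e * e * (- (wf W (om u v) * wg W (om u v)) / p)).
    - unfold p; field; auto.
    - rewrite He; ring. }
  assert (Hiff : forall x y, x = y <-> x / p = y / p).
  { intros x y; split; [now intros ->|].
    intros E; apply (Rmult_eq_reg_r (/ p)); [exact E|now apply Rinv_neq_0_compat]. }
  assert (Ek : forall (Z : weingarten) c d,
    natural_PDE k Z t0 c d om u v <->
    match k with
    | StronglyRegular => natural_term c (wf Z) (wg Z) t0 (fun s => om s v) u
        + natural_term d (wg Z) (wf Z) t0 (fun t => om u t) v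
        = - (wf Z (om u v) * wg Z (om u v))
    | Gamma1Zero => natural_term c (wf Z) (wg Z) t0 (fun s => om s v) u
        = - (wf Z (om u v) * wg Z (om u v))
    end).
  { intros Z c d; unfold natural_PDE, natural_term, pu, pv; cbv zeta.
    destruct k; [|reflexivity].
    now rewrite (Rmult_comm (Derive (fun t => wint (wg Z) (wf Z) t0 (om u t)) v)). }
  rewrite !Ek, HUt, HVt, Er.
  rewrite (Rmult_comm (1 - a * wg W (om u v))); fold p.
  destruct k; [|apply Hiff].
  rewrite <- Rdiv_plus_distr; apply Hiff.
Qed.

Theorem theorem4p2 (X : surface) (W : weingarten) (u0 v0 : R) (k : kind) (aa bb : R)
    (hX : has_natural_PDE X W u0 v0 k aa bb)
    (a : R) (ha : a <> 0) (h0 : dom (parallel a X) u0 v0)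
    (aa' bb' : R) (haa' : 0 < aa') (hbb' : 0 < bb')
    (eaa' : / aa' ^ 2 = / aa ^ 2 * (1 - a * wf W (wnu W u0 v0)) ^ 2)
    (ebb' : / bb' ^ 2 = / bb ^ 2 * (1 - a * wg W (wnu W u0 v0)) ^ 2) :
  let t0 := wnu W u0 v0 in
  let W' := parallel_weingarten a W t0 in
  let X' := restrict (parallel a X) (fun u v => itv W' (wnu W u v)) in
  has_natural_PDE X' W' u0 v0 k aa' bb' /\
  same_equation (itv W') (natural_PDE k W t0 aa bb) (natural_PDE k W' t0 aa' bb').
Proof.
  intros t0 W' X'.
  destruct hX as [HW D0 HN Hk Ha Hb Ea Eb].
  pose proof (ws_spacelike X W HW) as HX; pose proof (ws_principal X W HW) as HP.
  destruct h0 as [_ Hd0]; simpl in Hd0.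
  rewrite (ws_nu1 X W HW), (ws_nu2 X W HW) in Hd0 by auto.
  pose proof (ws_range X W HW u0 v0 D0) as K0.
  pose proof (parallel_weingarten_pair a t0 W (ws_itv X W HW) (ws_f X W HW) (ws_g X W HW)
    (ws_fg X W HW) K0 Hd0) as Hpp; fold W' in Hpp.
  set (e := sign _) in Hpp.
  assert (K0' : itv W' t0).
  { split; [exact K0|]. intros s Hs.
    unfold Rmin, Rmax in Hs; destruct (Rle_dec t0 t0);
      replace s with t0 by lra; exact Hd0. }
  assert (HX' : parallel_piece a e X X').
  { split.
    - (* The condition on [nu] alone cuts out the domain, and [nu] is continuous. *)
      intros u v [[Duv _] Kuv].
      assert (Hcont : continuity_2d_pt (wnu W) u v).
      { apply (C1_on_continuity_2d (dom X)); auto; [apply HX|apply (ws_nu X W HW)]. }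
      assert (Hloc : locally_2d (fun s t => itv W' (wnu W s t)) u v).
      { apply locally_2d_locally.
        apply (proj1 (continuity_2d_pt_filterlim (wnu W) u v) Hcont).
        now apply (proj1 (pp_itv _ _ _ _ _ _ _ Hpp)). }
      apply (locally_2d_impl (fun s t => dom X s t /\ itv W' (wnu W s t))).
      + apply locally_2d_forall; intros s t [Dst Kst]; split; [split|]; auto.
        rewrite (ws_nu1 X W HW), (ws_nu2 X W HW) by auto.
        apply Rmult_integral_contrapositive; split;
          [apply (pp_nzf _ _ _ _ _ _ _ Hpp)|apply (pp_nzg _ _ _ _ _ _ _ Hpp)]; auto.
      + apply locally_2d_and; auto; now apply (sl_open X HX).
    - now intros u v [[Duv _] _].
    - reflexivity.
    - (* On the segment from [t0] to [nu] the sign of the unit normal is constant. *)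
      intros u v [[Duv _] [Kuv Hs]]; simpl.
      rewrite (ws_nu1 X W HW), (ws_nu2 X W HW) by auto.
      f_equal; unfold e; symmetry.
      apply (same_sign_of_neq_0 (fun t => (1 - a * wf W t) * (1 - a * wg W t))).
      intros s Hr; split; [|now apply Hs].
      assert (Ks : itv W s).
      { apply (open_interval_between _ t0 (wnu W u v)); auto; apply (ws_itv X W HW). }
      pose proof (proj1 (ws_f X W HW s Ks)); pose proof (proj1 (ws_g X W HW s Ks)).
      apply (ex_derive_continuous (fun t => (1 - a * wf W t) * (1 - a * wg W t))).
      auto_derive; auto. }
  assert (HK : forall u v, dom X' u v -> itv W' (wnu W u v)) by now intros u v [_ Kuv].
  assert (D0' : dom X' u0 v0).
  { split; [split|]; auto. rewrite (ws_nu1 X W HW), (ws_nu2 X W HW); auto. }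
  assert (HW' : W_surface X' W').
  { apply (parallel_piece_W_surface a e X X' W W'); auto. now intros t [Kt _]. }
  assert (HN' : natural_parameters X' W' u0 v0).
  { now apply (parallel_piece_natural a e u0 v0 X X' W W'). }
  destruct (parallel_piece_metric a e X X' u0 v0 HX HP HX' D0') as (EE & _ & EG).
  rewrite (ws_nu1 X W HW) in EE by auto. rewrite (ws_nu2 X W HW) in EG by auto.
  split; [split; auto|].
  - apply (of_kind_iff k X' W' u0 v0 HW' D0' HN').
    intros u v Duv; apply (of_kind_iff k X W u0 v0 HW D0 HN); auto.
    now apply (pl_dom _ _ _ _ HX').
  - rewrite EE, eaa', Ea; ring.
  - rewrite EG, ebb', Eb; ring.
  - now apply (natural_PDE_parallel k a e).
Qed.
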